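(* For any maps $\iota\colon A \to Y$ and $f\colon X \to Y$ in $\mathcal{T}$, one has $\mathrm{liftcat}^{\mathrm{op}}_f(\iota) \leq \mathrm{liftcat}^{\mathrm{WG}}_f(\iota)$, and if $X$ is normal, then $\mathrm{liftcat}^{\mathrm{op}}_f(\iota) = \mathrm{liftcat}^{\mathrm{WG}}_f(\iota)$. In particular (with $f=\mathrm{id}_X$), for any map $\iota\colon A \to X$, one has $\mathrm{secat}^{\mathrm{op}}(\iota) \leq \mathrm{secat}^{\mathrm{WG}}(\iota)$, and if $X$ is normal, then $\mathrm{secat}^{\mathrm{op}}(\iota) = \mathrm{secat}^{\mathrm{WG}}(\iota)$.
   Context: $\mathcal{T}$ denotes either $\mathbf{Top}$ (topological spaces, continuous maps, free homotopies) or $\mathbf{Top}^w$ (well-pointed spaces, i.e. the inclusion of the basepoint is a closed cofibration; basepoint-preserving continuous maps; pointed homotopies). Spaces are non-empty. $\simeq$ means homotopic. Homotopy pullbacks and homotopy pushouts are the usual ones (Mather), for (strong) homotopy equivalences. A space is normal if any two disjoint closed subsets have disjoint open neighbourhoods (Hausdorff is not required). Open cover version: $\mathrm{liftcat}^{\mathrm{op}}_f(\iota)$ is the least integer $n$ for which there exist an open cover $(U_i)_{0\leq i\leq n}$ of $X$ and maps $l_i\colon U_i\to A$ with $\iota\circ l_i\simeq f|_{U_i}$ for all $i$ (and $\infty$ if there is no such $n$). In $\mathbf{Top}^w$ each $U_i$ must contain the basepoint of $X$ and the maps and homotopies are pointed. For $\iota\colon A\to Y$, $\mathrm{secat}^{\mathrm{op}}(\iota)=\mathrm{liftcat}^{\mathrm{op}}_{\mathrm{id}_Y}(\iota)$.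 Whitehead version: for $\iota\colon A\to Y$, define maps $t_i\colon T^i(\iota)\to Y^{i+1}$ inductively: $T^0(\iota)=A$, $t_0=\iota$; for $i>0$, $T^i(\iota)$ is the homotopy pushout of $$Y^i\times A \xleftarrow{\;t_{i-1}\times \mathrm{id}_A\;} T^{i-1}(\iota)\times A \xrightarrow{\;\mathrm{id}\times\iota\;} T^{i-1}(\iota)\times Y,$$ and $t_i\colon T^i(\iota)\to Y^{i+1}$ is the map induced by this homotopy pushout from $\mathrm{id}_{Y^i}\times\iota\colon Y^i\times A\to Y^{i+1}$ and $t_{i-1}\times \mathrm{id}_Y\colon T^{i-1}(\iota)\times Y\to Y^{i+1}$ (which agree on $T^{i-1}(\iota)\times A$). Then $\mathrm{liftcat}^{\mathrm{WG}}_f(\iota)$ is the least integer $n$ such that there is a map $l\colon X\to T^n(\iota)$ with $t_n\circ l\simeq \Delta_{n+1}\circ f$, where $\Delta_{n+1}\colon Y\to Y^{n+1}$ is the diagonal map (and $\infty$ if there is no such $n$). For $\iota\colon A\to Y$, $\mathrm{secat}^{\mathrm{WG}}(\iota)=\mathrm{liftcat}^{\mathrm{WG}}_{\mathrm{id}_Y}(\iota)$. *)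

(* Defs.v *)
From HB Require Import structures.
From Stdlib Require Import Relation_Operators.
From mathcomp Require Import all_boot all_order all_algebra generic_quotient.
From mathcomp Require Import mathcomp_extra boolp classical_sets functions.
From mathcomp Require Import reals ereal topology.

Set Implicit Arguments.
Unset Strict Implicit.
Unset Printing Implicit Defensive.

Import Order.TTheory GRing.Theory Num.Theory.
Import numFieldTopology.Exports.

Local Open Scope classical_set_scope.
Local Open Scope ring_scope.
Local Open Scope quotient_scope.

(* [Top] is the category of spaces with free homotopies and [Topw] that of
   well-pointed spaces with pointed homotopies.  The free and the pointed settings are handled together by equipping every
   space with a subset [base]: it is empty in the free setting, and it is the
   singleton of the basepoint in the pointed setting.  Morphisms and homotopies
   send [base] into [base]; this is no condition at all in the free setting,
   and preservation of the basepoint in the pointed one. *)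

Record bspace := BSpace {
  carrier :> topologicalType;
  base : set carrier
}.
Arguments base : clear implicits.

Inductive category := Top | Topw.

Definition unitI (R : realType) : topologicalType :=
  set_type (`[0, 1]%classic : set R).

Section UnitInterval.
Variable R : realType.

Lemma unitI0_subproof : (0 : R) \in (`[0, 1]%classic : set R).
Proof. by apply: mem_set; rewrite /= in_itv /= lexx ler01. Qed.

Lemma unitI1_subproof : (1 : R) \in (`[0, 1]%classic : set R).
Proof. by apply: mem_set; rewrite /= in_itv /= lexx ler01. Qed.

Definition I0 : unitI R := exist _ 0 unitI0_subproof.
Definition I1 : unitI R := exist _ 1 unitI1_subproof.

End UnitInterval.

(* Closed cofibration: homotopy extension property for the inclusion of the
   closed subset [B], with respect to all (unpointed) target spaces. *)
Definition closed_cofibration (R : realType) (X : topologicalType)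
    (B : set X) : Prop :=
  closed B /\
  forall (Z : topologicalType) (f : X -> Z) (h : B * unitI R -> Z),
    continuous f -> continuous h ->
    (forall b : B, h (b, I0 R) = f (set_val b)) ->
    exists H : X * unitI R -> Z,
      [/\ continuous H,
          forall x, H (x, I0 R) = f x &
          forall (b : B) s, H (set_val b, s) = h (b, s)].

Definition is_object (R : realType) (c : category) (X : bspace) : Prop :=
  match c with
  | Top => [set: X] !=set0 /\ base X = set0
  | Topw => exists2 x0 : X, base X = [set x0] & closed_cofibration R [set x0]
  end.

Definition is_map (X Y : bspace) (f : X -> Y) : Prop :=
  continuous f /\ (forall x, base X x -> base Y (f x)).

Definition homotopic (R : realType) (X Y : bspace) (f g : X -> Y) : Prop :=
  exists H : X * unitI R -> Y,
    [/\ continuous H,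
        forall x, H (x, I0 R) = f x,
        forall x, H (x, I1 R) = g x &
        forall x s, base X x -> base Y (H (x, s))].

Definition subspace_of (X : bspace) (U : set X) : bspace :=
  @BSpace (set_type U) (set_val @^-1` base X).

Definition prod_space (X Y : bspace) : bspace :=
  @BSpace (X * Y)%type (base X `*` base Y).

(* [power Y n] is the product of n + 1 copies of [Y]. *)
Fixpoint power (Y : bspace) (n : nat) : bspace :=
  if n is m.+1 then prod_space (power Y m) Y else Y.

Fixpoint diagonal_map (Y : bspace) (n : nat) : Y -> power Y n :=
  if n is m.+1 return Y -> power Y n then fun y => (diagonal_map m y, y)
  else idfun.

(* The homotopy pushout of [P <-f- C -g-> Q] is the double mapping cylinder:
   the quotient of the disjoint union of [P], [C * unitI R] and [Q] which
   identifies [(c, 0)] with [f c] and [(c, 1)] with [g c].  In the pointed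
   setting it is the reduced one: the segment over the basepoint of [C] is
   moreover collapsed to a point, namely the basepoint of the quotient. *)

Inductive piece := LeftPiece | CylPiece | RightPiece.

Definition piece_code (i : piece) : option bool :=
  match i with
  | LeftPiece => Some false | CylPiece => None | RightPiece => Some true
  end.
Definition piece_decode (o : option bool) : piece :=
  match o with
  | Some false => LeftPiece | None => CylPiece | Some true => RightPiece
  end.
Lemma piece_codeK : cancel piece_code piece_decode. Proof. by case. Qed.
HB.instance Definition _ := Choice.copy piece (can_type piece_codeK).

Section HomotopyPushout.
Variables (R : realType) (C P Q : bspace) (f : C -> P) (g : C -> Q).

Definition piece_space (i : piece) : topologicalType :=
  match i with
  | LeftPiece => P
  | CylPiece => (C * unitI R)%type
  | RightPiece => Q
  end.

Definition cyl_sum : topologicalType := {i : piece & piece_space i}.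

Definition in_left (p : P) : cyl_sum := existT piece_space LeftPiece p.
Definition in_cyl (z : C * unitI R) : cyl_sum :=
  existT piece_space CylPiece z.
Definition in_right (q : Q) : cyl_sum := existT piece_space RightPiece q.

Inductive cyl_glue : cyl_sum -> cyl_sum -> Prop :=
| GlueLeft c : cyl_glue (in_cyl (c, I0 R)) (in_left (f c))
| GlueRight c : cyl_glue (in_cyl (c, I1 R)) (in_right (g c))
| GlueBase c s : base C c -> cyl_glue (in_cyl (c, s)) (in_left (f c)).

Definition cyl_rel_bool (z w : cyl_sum) : bool :=
  `[< clos_refl_sym_trans cyl_sum cyl_glue z w >].

Lemma cyl_rel_refl : reflexive cyl_rel_bool.
Proof. by move=> z; apply/asboolP; exact: rst_refl. Qed.

Lemma cyl_rel_sym : symmetric cyl_rel_bool.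
Proof.
by move=> z w; apply/idP/idP => /asboolP zw; apply/asboolP; exact: rst_sym.
Qed.

Lemma cyl_rel_trans : transitive cyl_rel_bool.
Proof.
by move=> w z v /asboolP zw /asboolP wv; apply/asboolP; exact: rst_trans wv.
Qed.

Definition cyl_rel := EquivRel _ cyl_rel_refl cyl_rel_sym cyl_rel_trans.

Definition cylinder := quotient_topology {eq_quot cyl_rel}.

Definition hpushout : bspace :=
  @BSpace cylinder ((fun p => \pi_cylinder (in_left p)) @` base P).

(* The map out of the homotopy pushout induced by maps [p] and [q] such that
   [p \o f = q \o g] (it is the constant homotopy on the cylinder). *)
Definition hpushout_map (Z : Type) (p : P -> Z) (q : Q -> Z) : hpushout -> Z :=
  fun z : cylinder =>
    match repr z : {i & piece_space i} with
    | existT LeftPiece x => p x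
    | existT CylPiece x => p (f x.1)
    | existT RightPiece x => q x
    end.

End HomotopyPushout.
Arguments hpushout_map {R C P Q f g Z} p q _.

(* The Whitehead version: the pair of [T^n(iota)] and
   [t_n : T^n(iota) -> Y^(n+1)], built by a single recursion since [T^(n+1)]
   depends on [t_n]. *)
Fixpoint wg (R : realType) (A Y : bspace) (iota : A -> Y) (n : nat) :
    {T : bspace & T -> power Y n} :=
  match n return {T : bspace & T -> power Y n} with
  | 0%N => existT (fun T : bspace => T -> power Y 0) A iota
  | m.+1 =>
    let T := projT1 (wg R iota m) in
    let t : T -> power Y m := projT2 (wg R iota m) in
    let f : prod_space T A -> prod_space (power Y m) A :=
      fun z => (t z.1, z.2) in
    let g : prod_space T A -> prod_space T Y := fun z => (z.1, iota z.2) in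
    existT (fun T : bspace => T -> power Y m.+1) (hpushout R f g)
      (hpushout_map (fun z : prod_space (power Y m) A => (z.1, iota z.2))
                    (fun z : prod_space T Y => (t z.1, z.2)))
  end.

Definition wg_space (R : realType) (A Y : bspace) (iota : A -> Y) (n : nat) :
  bspace := projT1 (wg R iota n).

Definition wg_map (R : realType) (A Y : bspace) (iota : A -> Y) (n : nat) :
  wg_space R iota n -> power Y n := projT2 (wg R iota n).
Arguments wg_map R {A Y} iota n _.

(* [\bar int] provides the order on the naturals with infinity: the value is
   a natural number or [+oo], the latter when [S] is empty. *)
Definition least (S : set nat) : \bar int :=
  if pselect (exists n, `[< S n >]) is left ex then (ex_minn ex)%:Z%:E
  else +oo%E.

Section LiftCat.
Variables (R : realType) (A X Y : bspace) (f : X -> Y) (iota : A -> Y).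

Definition has_open_lifts (n : nat) : Prop :=
  exists U : 'I_n.+1 -> set X,
    [/\ forall i, open (U i),
        \bigcup_i U i = setT,
        forall i, base X `<=` U i &
        forall i, exists l : subspace_of (U i) -> A,
          is_map l /\
          homotopic R (X := subspace_of (U i)) (iota \o l) (f \o set_val)].

Definition liftcat_op : \bar int := least has_open_lifts.

Definition has_wg_lift (n : nat) : Prop :=
  exists l : X -> wg_space R iota n,
    is_map l /\ homotopic R (wg_map R iota n \o l) (diagonal_map n \o f).

Definition liftcat_WG : \bar int := least has_wg_lift.

End LiftCat.

Definition secat_op (R : realType) (A Y : bspace) (iota : A -> Y) : \bar int :=
  liftcat_op R (X := Y) idfun iota.

Definition secat_WG (R : realType) (A Y : bspace) (iota : A -> Y) : \bar int :=
  liftcat_WG R (X := Y) idfun iota.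

(* Main.v *)
(** From WG to op: over the half of the double mapping cylinder [T^(n+1)] near
    [Y^(n+1) * A], the last coordinate of [t_(n+1)] lifts strictly through
    [iota]; the other half projects to [T^n], whose cover is pulled back.  So
    [T^n] has a cover with strict lifts, which is pulled back to [X].

    In the pointed setting the cylinder is reduced, so an open set around the
    basepoint meets both halves.  Retractions coming from the homotopy extension
    property of the basepoints of [A] and [Y] enlarge the left half to a
    neighbourhood of the basepoint, with a pointed lift up to homotopy.  The
    other lifts are only free; they are made pointed on [X] by collapsing a
    neighbourhood of its basepoint.

    From op to WG, for [X] normal: a Urysohn function separating the complements
    of [U_n] and of the union of the other [U_i] serves as the cylinder
    coordinate, which glues [l_n] and a map into [T^(n-1)] obtained by induction
    on a closed, hence normal, subspace. *)
From Stdlib Require Import Relation_Operators.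
Require Import Defs.
From mathcomp Require Import all_boot all_order all_algebra.
From mathcomp Require Import ring lra.
From mathcomp Require Import boolp classical_sets functions.
From mathcomp Require Import reals ereal topology normedtype.

Set Implicit Arguments.
Unset Strict Implicit.
Unset Printing Implicit Defensive.

Import Order.TTheory GRing.Theory Num.Theory.
Import numFieldNormedType.Exports.

Local Open Scope classical_set_scope.
Local Open Scope ring_scope.
Local Open Scope quotient_scope.

(** * Continuity at a point, and pasting *)

Section PointwiseContinuity.
Variables (R : realType) (X Y Z : topologicalType).
Implicit Types (x : X) (b : X -> R).

Lemma for_continuous_comp x (f : X -> Y) (g : Y -> Z) :
  {for x, continuous f} -> {for f x, continuous g} ->
  {for x, continuous (fun y => g (f y))}.
Proof. exact: continuous_comp. Qed.

Lemma for_continuous_pair x (f : X -> Y) (g : X -> Z) :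
  {for x, continuous f} -> {for x, continuous g} ->
  {for x, continuous (fun y => (f y, g y))}.
Proof. by move=> cf cg; exact: cvg_pair. Qed.

Lemma for_continuous_near x (f g : X -> Z) :
  (\forall y \near x, f y = g y) ->
  {for x, continuous f} -> {for x, continuous g}.
Proof.
move=> fg cf; have fgx : f x = g x := nbhs_singleton fg.
move=> O; rewrite -fgx => /cf; rewrite !nbhs_simpl => Of.
by apply: filterS2 fg Of => y /= <-.
Qed.

(** Pasting at a single point. A branch has to be continuous only if the point lies on its side of
    the wall, so the branches may be lifts that are meaningful on part of [X] only. *)
Lemma for_continuous_if_le x b (c : R) (f g : X -> Z) :
  {for x, continuous b} ->
  (b x <= c -> {for x, continuous f}) ->
  (c <= b x -> {for x, continuous g}) ->
  (b x = c -> f x = g x) ->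
  {for x, continuous (fun y => if b y <= c then f y else g y)}.
Proof.
move=> cb cf cg fg; case: (ltgtP (b x) c) => bc.
- apply: for_continuous_near (cf (ltW bc)).
  have : \forall y \near x,
    b y < c by exact: (cb [set r | r < c]) (lt_nbhsl bc).
  by apply: filterS => y /ltW ->.
- apply: for_continuous_near (cg (ltW bc)).
  have : \forall y \near x,
    c < b y by exact: (cb [set r | c < r]) (lt_nbhsr bc).
  by apply: filterS => y /lt_geF ->.
- have {}cf : {for x, continuous f} by apply: cf; rewrite bc.
  have {}cg : {for x, continuous g} by apply: cg; rewrite bc.
  move=> O; rewrite bc lexx => Ofx.
  have Of : \forall y \near x, O (f y) by exact: cf.
  have Og : \forall y \near x, O (g y) by apply: cg; rewrite -fg.
  apply: filterS2 Of Og => y Of Og /=.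
  by case: ifP.
Qed.

End PointwiseContinuity.

Lemma continuous_set_type (X Y : topologicalType) (D : set X) (f : Y -> D) :
  continuous (fun y => set_val (f y)) -> continuous f.
Proof. by move=> cf; exact/continuous_comp_initial. Qed.

Lemma set_val_cts (X : topologicalType) (D : set X) : continuous (@set_val X D).
Proof. exact: initial_continuous. Qed.

(** * Clamping the real line to the unit interval *)

Section Reals.
Variable R : realType.
Implicit Types (r s : R).

Definition clamp r : R := Num.max 0 (Num.min 1 r).

Lemma clamp_itv r : clamp r \in (`[0, 1]%classic : set R).
Proof.
apply: mem_set; rewrite /= in_itv /= /clamp.
by rewrite le_max lexx /= ge_max ler01 ge_min lexx.
Qed.

Lemma clamp_le0 r : r <= 0 -> clamp r = 0.
Proof.
by move=> r0; rewrite /clamp (min_idPr (le_trans r0 ler01)) (max_idPl r0).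
Qed.

Lemma clamp_ge1 r : 1 <= r -> clamp r = 1.
Proof. by move=> r1; rewrite /clamp (min_idPl r1) (max_idPr ler01). Qed.

Lemma clamp_id r : 0 <= r <= 1 -> clamp r = r.
Proof.
by move=> /andP[r0 r1]; rewrite /clamp (min_idPr r1) (max_idPr r0).
Qed.

Lemma clamp_gt0 r : 0 < r -> 0 < clamp r.
Proof. by move=> r0; rewrite lt_max lt_min ltr01 r0 orbT. Qed.

Lemma continuous_clamp : continuous clamp.
Proof.
move=> r; apply: continuous_max; first exact: cvg_cst.
by apply: continuous_min; [exact: cvg_cst|exact: cvg_id].
Qed.

Definition to_unitI r : unitI R := exist _ (clamp r) (clamp_itv r).

Lemma set_val_unitI (s : unitI R) : 0 <= set_val s <= 1.
Proof. by have := set_valP s; rewrite /= in_itv. Qed.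

Lemma set_val_unitIK (s : unitI R) : to_unitI (set_val s) = s.
Proof. by apply: val_inj => /=; exact/clamp_id/set_val_unitI. Qed.

Lemma to_unitI0 : to_unitI 0 = I0 R.
Proof. by apply: val_inj => /=; rewrite clamp_le0. Qed.

Lemma to_unitI1 : to_unitI 1 = I1 R.
Proof. by apply: val_inj => /=; rewrite clamp_ge1. Qed.

Lemma continuous_to_unitI : continuous to_unitI.
Proof. by apply: continuous_set_type; exact: continuous_clamp. Qed.

End Reals.

(** * Products of a final topology with the real line *)

Section FinalTopology.
Variables (R : realType) (I : Type) (S : I -> topologicalType).
Variables (Q : topologicalType) (e : forall i, S i -> Q).
Arguments e {i}.
Hypothesis e_surj : forall z, exists i, exists x : S i, z = e x.
Hypothesis e_open : forall V : set Q, (forall i, open (@e i @^-1` V)) -> open V.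

(* Whitehead's lemma: the set of the z for which {z} x J is mapped into a given
   open set is open by the tube lemma, since J is compact. *)
Lemma final_prod_continuous (Z : topologicalType) (h : Q * R -> Z) :
  (forall i, continuous (fun y : S i * R => h (e y.1, y.2))) -> continuous h.
Proof.
move=> ch; apply/continuousP => O oO; rewrite openE => -[z r] /= Ozr.
have [d d0 zO] : exists2 d : R, 0 < d &
    forall s, s \in `[r - d, r + d] -> O (h (z, s)).
  have [i [x zE]] := e_surj z; rewrite {}zE in Ozr *.
  have cx : {for r, continuous (fun s => h (e x, s))}.
    apply: (@for_continuous_comp _ _ _ r (fun s => (x, s)) _ _ (@ch i (x, r))).
    by apply: for_continuous_pair; [exact: cvg_cst|exact: cvg_id].
  have /cx : nbhs (h (e x, r)) O by exact: open_nbhs_nbhs.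
  rewrite nbhs_simpl /= -nbhs_ballE => -[d /= d0 dO].
  (* Half the radius, so that the closed interval stays inside the open ball. *)
  exists (d / 2); first by rewrite divr_gt0.
  move=> s; rewrite in_itv /= => /andP[s1 s2]; apply: dO => /=.
  by rewrite /ball /= ltr_distlC; apply/andP; split; lra.
pose W := [set w | forall s, s \in `[r - d, r + d] -> O (h (w, s))].
have oW : open W.
  (* Openness is checked on each piece [S i], where the continuity [ch] and the compactness of the
     segment can be used. *)
  apply: e_open => i; rewrite openE => x /= xW.
  have /compact_near_coveringP cK := @segment_compact R (r - d) (r + d).
  apply: (cK _ (nbhs x) (fun w s => O (h (e w, s)))) => s rs.
  have /(@ch i (x, s)) [[A B] /= [xA sB] AB] : nbhs (h (e x, s)) O.
    by apply: open_nbhs_nbhs; split => //; exact: xW.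
  by exists (B, A) => //= -[s' x'] [/= Bs' Ax']; exact: (AB (x', s')).
exists (W, ball r d); first by split;
  [exact: open_nbhs_nbhs|exact: nbhsx_ballx].
move=> [w s] /= [Ww]; rewrite /ball /= ltr_distlC => /andP[rs sr]; apply: Ww.
by rewrite in_itv /=; apply/andP; split; apply: ltW; lra.
Qed.

End FinalTopology.

(** * Topology of the double mapping cylinder and maps out of it *)

Section HomotopyPushoutTheory.
Variables (R : realType) (C P Q : bspace) (f : C -> P) (g : C -> Q).
Local Notation M := (hpushout R f g).

Definition hp_left (x : P) : M :=
  \pi_(cylinder R f g) (@in_left R C P Q x).
Definition hp_cyl (z : C * unitI R) : M :=
  \pi_(cylinder R f g) (@in_cyl R C P Q z).
Definition hp_right (x : Q) : M :=
  \pi_(cylinder R f g) (@in_right R C P Q x).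

Lemma hp_glueP (z w : cyl_sum R C P Q) :
  cyl_glue f g z w -> \pi_(cylinder R f g) z = \pi_(cylinder R f g) w.
Proof. by move=> zw; apply/eqmodP/asboolP; exact: rst_step. Qed.

Lemma hp_cyl0 c : hp_cyl (c, I0 R) = hp_left (f c).
Proof. exact/hp_glueP/GlueLeft. Qed.

Lemma hp_cyl1 c : hp_cyl (c, I1 R) = hp_right (g c).
Proof. exact/hp_glueP/GlueRight. Qed.

Lemma hp_cyl_base c s : base C c -> hp_cyl (c, s) = hp_left (f c).
Proof. by move=> Cc; exact/hp_glueP/GlueBase. Qed.

Lemma hp_right_base c : base C c -> hp_right (g c) = hp_left (f c).
Proof. by move=> Cc; rewrite -hp_cyl1 hp_cyl_base. Qed.

(** The three structure maps as one dependent family, the form in which [final_prod_continuous]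
    takes a final topology. *)
Definition hp_piece (i : piece) : piece_space R C P Q i -> M :=
  match i return piece_space R C P Q i -> M with
  | LeftPiece => hp_left
  | CylPiece => hp_cyl
  | RightPiece => hp_right
  end.
Arguments hp_piece {i} x.

Lemma hp_piece_surj (z : M) : exists i, exists x : piece_space R C P Q i,
  z = hp_piece x.
Proof.
rewrite -[z]reprK; case: (repr z) => i x; exists i, x.
by case: i x.
Qed.

Lemma hp_pieceE i (V : set M) :
  @hp_piece i @^-1` V =
  existT _ i @^-1` (\pi_(cylinder R f g) @^-1` V).
Proof. by case: i. Qed.

Lemma hp_piece_open (V : set M) :
  (forall i, open (@hp_piece i @^-1` V)) -> open V.
Proof.
by move=> oV; apply/sigT_openP => i; have := oV i; rewrite hp_pieceE.
Qed.

Lemma hp_piece_continuous i : continuous (@hp_piece i).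
Proof.
apply/continuousP => V oV; rewrite hp_pieceE.
by move/sigT_openP : oV; exact.
Qed.

Lemma hpushout_ind (K : M -> Prop) :
  (forall x, K (hp_left x)) -> (forall c s, K (hp_cyl (c, s))) ->
  (forall x, K (hp_right x)) -> forall z, K z.
Proof.
move=> Kl Kc Kr z; have [i [x ->]] := hp_piece_surj z.
by case: i x => [x|[c s]|x] /=.
Qed.

Lemma hpushout_open (V : set M) :
  open (hp_left @^-1` V) -> open (hp_cyl @^-1` V) -> open (hp_right @^-1` V) ->
  open V.
Proof. by move=> *; apply: hp_piece_open => -[]. Qed.

(** The part of [V] sent into a given open set has open preimages in the three pieces, hence is
    open. The restriction to [V] matters for lifts that are continuous on one half of the cylinder
    only. *)
Lemma hpushout_for_continuous (Z : topologicalType) (h : M -> Z) (V : set M) :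
  open V ->
  (forall x, V (hp_left x) -> {for x, continuous (h \o hp_left)}) ->
  (forall y, V (hp_cyl y) -> {for y, continuous (h \o hp_cyl)}) ->
  (forall x, V (hp_right x) -> {for x, continuous (h \o hp_right)}) ->
  forall z, V z -> {for z, continuous h}.
Proof.
move=> oV cl cc cr z Vz O; rewrite nbhsE => -[O' [oO' O'z] O'O].
apply: (@filterS _ _ _ (V `&` h @^-1` O')) => [w [_ /O'O]//|].
apply: open_nbhs_nbhs; split => //.
apply: hp_piece_open => i; rewrite openE => x -[Vx O'x].
rewrite /interior preimage_setI; apply: filterI.
  apply: open_nbhs_nbhs; split => //.
  by move/continuousP : (@hp_piece_continuous i); exact.
have : {for x, continuous (h \o @hp_piece i)} by case: i x Vx {O'x}; eauto.
by apply; exact: open_nbhs_nbhs.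
Qed.

Lemma hpushout_prod_continuous (Z : topologicalType) (h : M * R -> Z) :
  continuous (fun y : P * R => h (hp_left y.1, y.2)) ->
  continuous (fun y : (C * unitI R) * R => h (hp_cyl y.1, y.2)) ->
  continuous (fun y : Q * R => h (hp_right y.1, y.2)) ->
  continuous h.
Proof.
move=> cl cc cr; apply: (final_prod_continuous hp_piece_surj hp_piece_open).
by case.
Qed.

Section Rec.
Variables (Z : Type) (p : P -> Z) (m : C * unitI R -> Z) (q : Q -> Z).

Definition cyl_rec (z : cyl_sum R C P Q) : Z :=
  match z with
  | existT LeftPiece x => p x
  | existT CylPiece x => m x
  | existT RightPiece x => q x
  end.

Definition hpushout_rec (z : M) : Z := cyl_rec (repr (z : cylinder R f g)).

Hypothesis m0 : forall c, m (c, I0 R) = p (f c).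
Hypothesis m1 : forall c, m (c, I1 R) = q (g c).
Hypothesis mb : forall c s, base C c -> m (c, s) = p (f c).

(** Independence of the representative: [m0], [m1] and [mb] make [cyl_rec] constant along the three
    kinds of gluing, hence along the equivalence relation that they generate. *)
Lemma hpushout_rec_pi z :
  hpushout_rec (\pi_(cylinder R f g) z) = cyl_rec z.
Proof.
have zw w : clos_refl_sym_trans _ (cyl_glue f g) w z -> cyl_rec w = cyl_rec z.
  elim => {w} [_ _ [c|c|c s Cc]|//|x y _ ->|x y w _ -> _ ->] //=.
  exact: mb.
by apply/zw/asboolP; apply/(@eqmodP _ (cyl_rel R f g)); rewrite reprK.
Qed.

Lemma hpushout_rec_left x : hpushout_rec (hp_left x) = p x.
Proof. exact: hpushout_rec_pi. Qed.
Lemma hpushout_rec_cyl x : hpushout_rec (hp_cyl x) = m x.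
Proof. exact: hpushout_rec_pi. Qed.
Lemma hpushout_rec_right x : hpushout_rec (hp_right x) = q x.
Proof. exact: hpushout_rec_pi. Qed.

End Rec.

Lemma hpushout_mapE (Z : Type) (p : P -> Z) (q : Q -> Z) :
  hpushout_map p q = hpushout_rec p (fun x => p (f x.1)) q.
Proof. by []. Qed.

End HomotopyPushoutTheory.

(** * Lifts up to homotopy over a subset *)

(* The lift and the homotopy are total functions, only required to be continuous
   at the points of [U], and the homotopy parameter ranges over the whole real
   line. *)
Record lift_data (R : realType) (X A Y : bspace) (iota : A -> Y) (g : X -> Y)
    (U : set X) (l : X -> A) (H : X * R -> Y) : Prop := LiftData {
  lift_cts : forall x, U x -> {for x, continuous l};
  lift_homotopy_cts : forall x (r : R), U x -> {for (x, r), continuous H};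
  lift_homotopy0 : forall x, U x -> H (x, 0) = iota (l x);
  lift_homotopy1 : forall x, U x -> H (x, 1) = g x;
  lift_base : forall x, U x -> base X x -> base A (l x);
  lift_homotopy_base : forall x r, U x -> base X x -> base Y (H (x, r))
}.

Definition lift_on (R : realType) (X A Y : bspace) (iota : A -> Y) (g : X -> Y)
    (U : set X) : Prop :=
  exists l : X -> A, exists H : X * R -> Y, lift_data iota g U l H.

(** Clamping the parameter prolongs the homotopy by constants beyond both ends. *)
Lemma homotopic_real (R : realType) (X Y : bspace) (f g : X -> Y) :
  homotopic R f g ->
  exists G : X * R -> Y, [/\ continuous G, forall x, G (x, 0) = f x,
    forall x, G (x, 1) = g x & forall x r, base X x -> base Y (G (x, r))].
Proof.
move=> [H [cH H0 H1 Hb]]; exists (fun z => H (z.1, to_unitI z.2)); split => /=.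
- move=> z; apply: (@for_continuous_comp _ _ _ z (fun z => (z.1,
    to_unitI z.2))).
    apply: for_continuous_pair; first exact: cvg_fst.
    by apply: for_continuous_comp; [exact: cvg_snd|exact: continuous_to_unitI].
  exact: cH.
- by move=> x; rewrite to_unitI0.
- by move=> x; rewrite to_unitI1.
- by move=> x r; exact: Hb.
Qed.

Section LiftOn.
Variables (R : realType) (X A Y : bspace) (iota : A -> Y).
Implicit Types (g : X -> Y) (U : set X).

Lemma lift_onW g U V : V `<=` U -> lift_on R iota g U -> lift_on R iota g V.
Proof.
move=> VU [l [H [cl cH H0 H1 lb Hb]]]; exists l, H.
by split => [x|x r|x|x|x|x r] /VU; auto.
Qed.

Lemma lift_on_comp (X' : bspace) (k : X' -> X) (U' : set X') g U :
  (forall x, U' x -> {for x, continuous k}) -> (forall x, U' x -> U (k x)) ->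
  (forall x, U' x -> base X' x -> base X (k x)) ->
  lift_on R iota g U -> lift_on R iota (g \o k) U'.
Proof.
move=> ck kU kb [l [H [cl cH H0 H1 lb Hb]]].
exists (l \o k), (fun z => H (k z.1, z.2)); split => /=.
- by move=> x U'x; apply: for_continuous_comp; [exact: ck|apply/cl/kU].
- move=> x r U'x.
  apply: (@for_continuous_comp _ _ _ (x, r) (fun z => (k z.1, z.2))).
    apply: for_continuous_pair; last exact: cvg_snd.
    by apply: for_continuous_comp; [exact: cvg_fst|exact: ck].
  by apply: cH; exact: kU.
- by move=> x /kU; exact: H0.
- by move=> x /kU; exact: H1.
- by move=> x U'x bx; apply: lb; [exact: kU|exact: kb].
- by move=> x r U'x bx; apply: Hb; [exact: kU|exact: kb].
Qed.

(** The lift is kept, and its homotopy is followed by [G], each run at double speed. As all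
    conditions are restricted to [U], a constant [G] also serves to replace [g] by a map equal to it
    on [U]. *)
Lemma lift_on_homotopy g g' (G : X * R -> Y) U :
  (forall x (r : R), U x -> {for (x, r), continuous G}) ->
  (forall x, U x -> G (x, 0) = g x) -> (forall x, U x -> G (x, 1) = g' x) ->
  (forall x r, U x -> base X x -> base Y (G (x, r))) ->
  lift_on R iota g U -> lift_on R iota g' U.
Proof.
move=> cG G0 G1 Gb [l [H [cl cH H0 H1 lb Hb]]].
pose a : R := 1 / 2.
exists l, (fun z => if z.2 <= a then H (z.1, 2 * z.2) else G (z.1,
  2 * z.2 - 1)).
have c2 (r : R) : {for r, continuous (fun s : R => 2 * s)}.
  by apply: cvgM; [exact: cvg_cst|exact: cvg_id].
split => //=.
- move=> x r Ux.
  apply: (@for_continuous_if_le _ _ _ (x, r) (fun z => z.2) a (fun z => H (z.1,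
    2 * z.2)) (fun z => G (z.1, 2 * z.2 - 1))) => /=.
  + exact: cvg_snd.
  + move=> _; apply: (@for_continuous_comp _ _ _ (x, r) (fun z => (z.1,
      2 * z.2))).
      apply: for_continuous_pair; first exact: cvg_fst.
      by apply: (@for_continuous_comp _ _ _ (x, r)); [exact: cvg_snd|exact: c2].
    exact: cH.
  + move=> _; apply: (@for_continuous_comp _ _ _ (x, r) (fun z => (z.1,
      2 * z.2 - 1))).
      apply: for_continuous_pair; first exact: cvg_fst.
      apply: cvgB; last exact: cvg_cst.
      by apply: (@for_continuous_comp _ _ _ (x, r)); [exact: cvg_snd|exact: c2].
    exact: cG.
  + by move=> ->; rewrite /a mul1r mulfV// subrr G0// H1.
- by move=> x Ux; rewrite mulr0 divr_ge0// H0.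
- move=> x Ux; rewrite ifN; last by rewrite -ltNge /a; lra.
  by rewrite mulr1 (_ : 2 - 1 = 1)// ?G1//; lra.
- by move=> x r Ux bx; case: ifP => _; [exact: Hb|exact: Gb].
Qed.

(** Near each point of the union only one of the two lifts is in force, so no compatibility between
    them is required. *)
Lemma lift_on_setU g U V : open U -> open V -> U `&` V = set0 ->
  lift_on R iota g U -> lift_on R iota g V -> lift_on R iota g (U `|` V).
Proof.
move=> oU oV UV0 [l [H [cl cH H0 H1 lb Hb]]] [l' [H' [cl' cH' H0' H1' lb'
  Hb']]].
exists (fun x => if x \in U then l x else l' x).
exists (fun z => if z.1 \in U then H z else H' z).
have UI x : U x -> x \in U by move/mem_set.
have VI x : V x -> x \in U = false.
  move=> Vx; apply/negP => /set_mem Ux.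
  by have : (U `&` V) x by []; rewrite UV0.
have nU x : U x -> \forall y \near x, y \in U.
  by move=> Ux; apply: filterS (open_nbhs_nbhs (conj oU Ux)) => y /UI.
have nV x : V x -> \forall y \near x, y \in U = false.
  by move=> Vx; apply: filterS (open_nbhs_nbhs (conj oV Vx)) => y /VI.
have nfst (E : set X) (x : X) (r : R) :
    (\forall y \near x, E y) -> \forall z \near (x, r), E z.1.
  by move=> Ex; exact: (@cvg_fst _ _ (nbhs x) (nbhs r) _ _ Ex).
split => /=.
- move=> x [Ux|Vx].
  + by apply: for_continuous_near (cl _ Ux); apply: filterS (nU _ Ux) => y ->.
  + by apply: for_continuous_near (cl' _ Vx); apply: filterS (nV _ Vx) => y ->.
- move=> x r [Ux|Vx].
  + apply: for_continuous_near (cH _ r Ux).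
    by apply: filterS (nfst _ _ r (nU _ Ux)) => y ->.
  + apply: for_continuous_near (cH' _ r Vx).
    by apply: filterS (nfst _ _ r (nV _ Vx)) => y ->.
- by move=> x [/[dup]/UI -> /H0|/[dup]/VI -> /H0'].
- by move=> x [/[dup]/UI -> /H1|/[dup]/VI -> /H1'].
- by move=> x [/[dup]/UI -> /lb|/[dup]/VI -> /lb'].
- by move=> x r [/[dup]/UI -> /(Hb x r)|/[dup]/VI -> /(Hb' x r)].
Qed.

Lemma lift_on_subspace g U : lift_on R iota g U ->
  exists l : subspace_of U -> A, is_map l /\
    homotopic R (X := subspace_of U) (iota \o l) (g \o set_val).
Proof.
move=> [l [H [cl cH H0 H1 lb Hb]]]; exists (l \o set_val); split.
  split => [x|x bx] /=; last by apply: lb => //; exact: set_valP.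
  apply: (@for_continuous_comp _ _ _ x (@set_val X U));
    first exact: set_val_cts.
  by apply: cl; exact: set_valP.
exists (fun z => H (set_val z.1, set_val z.2)); split => /=.
- move=> z.
  apply: (@for_continuous_comp _ _ _ z (fun z => (set_val z.1, set_val z.2))).
    apply: for_continuous_pair.
      by apply: for_continuous_comp; [exact: cvg_fst|exact: set_val_cts].
    by apply: for_continuous_comp; [exact: cvg_snd|exact: set_val_cts].
  by apply: cH; exact: set_valP.
- by move=> x; rewrite H0//; exact: set_valP.
- by move=> x; rewrite H1//; exact: set_valP.
- by move=> x s bx; apply: Hb => //; exact: set_valP.
Qed.

(** A map on the subspace [D] is made total by precomposition with the set-theoretic retraction [pt]
    of [X] onto [D]. It is continuous at interior points, because [D] is a neighbourhood of those in
    [X]. The value [a0] serves an empty [D]. *)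
Lemma lift_on_interior g (D : set X) (a0 : A) (l : subspace_of D -> A) :
  is_map l -> homotopic R (X := subspace_of D) (iota \o l) (g \o set_val) ->
  lift_on R iota g D°.
Proof.
move=> [cl lb] /homotopic_real[H [cH H0 H1 Hb]].
have [[d Dd]|D0] := pselect (D !=set0); last first.
  exists (fun=> a0), (fun=> iota a0).
  by split => [x|x r|x|x|x|x r] /interior_subset Dx; exfalso; apply: D0;
    exists x.
pose d' : D := exist _ d (mem_set Dd).
pose pt x : D := if pselect (x \in D) is left h then exist _ x h else d'.
have ptE x : D x -> set_val (pt x) = x.
  by move=> Dx; rewrite /pt; case: pselect => // -[]; exact: mem_set.
have cpt x : D° x -> {for x, continuous pt}.
  move=> Dx O [_ [/= [W oW <-] Wx WO]].
  rewrite nbhs_simpl; have {}Wx : W x.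
    by move: Wx; rewrite /= ptE//; exact: interior_subset.
  apply: filterS2 (open_nbhs_nbhs (conj oW Wx)) Dx => y Wy Dy.
  by apply: WO => /=; rewrite ptE.
exists (l \o pt), (fun z => H (pt z.1, z.2)); split => /=.
- by move=> x Dx; apply: (@for_continuous_comp _ _ _ x pt);
    [exact: cpt|exact: cl].
- move=> x r Dx; apply: (@for_continuous_comp _ _ _ (x, r) (fun z => (pt z.1,
    z.2))).
    apply: for_continuous_pair; last exact: cvg_snd.
    by apply: for_continuous_comp; [exact: cvg_fst|exact: cpt].
  exact: cH.
- by move=> x _; rewrite H0.
- by move=> x /interior_subset Dx; rewrite H1 /= ptE.
- by move=> x /interior_subset Dx bx; apply: lb; rewrite /= ptE.
- by move=> x r /interior_subset Dx bx; apply: Hb; rewrite /= ptE.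
Qed.

(** Translation into the language of [lift_on], with natural numbers as indices so that the
    inductions on [n] need no casts between ordinals. *)
Lemma has_open_liftsP g (a0 : A) n : has_open_lifts R g iota n <->
  exists U : nat -> set X,
    [/\ forall i, (i <= n)%N -> open (U i),
        forall x, exists2 i, (i <= n)%N & U i x,
        forall i, (i <= n)%N -> base X `<=` U i &
        forall i, (i <= n)%N -> lift_on R iota g (U i)].
Proof.
split.
- move=> [U [oU cU bU lU]]; exists (fun i => U (inord i)); split => // [x|i _].
    have : (\bigcup_i U i) x by rewrite cU.
    by move=> [i _ Uix]; exists i; rewrite ?inord_val// -ltnS.
  have [l [ml hl]] := lU (inord i).
  have /interior_id <- := oU (inord i).
  exact: lift_on_interior ml hl.
- move=> [U [oU cU bU lU]]; exists (fun i => U i); split => [i||i|i].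
  + by apply: oU; rewrite -ltnS.
  + apply/seteqP; split => // x _; have [i ni Uix] := cU x.
    by exists (Ordinal (ni : (i < n.+1)%N)).
  + by apply: bU; rewrite -ltnS.
  + by apply: lift_on_subspace; apply: lU; rewrite -ltnS.
Qed.

Lemma lift_on_setTP g : lift_on R iota g setT <->
  exists l : X -> A, is_map l /\ homotopic R (iota \o l) g.
Proof.
split.
- move=> [l [H [cl cH H0 H1 lb Hb]]]; exists l; split.
    by split => x; [exact: cl|exact: lb].
  exists (fun z => H (z.1, set_val z.2)); split => /=.
  + move=> z; apply: (@for_continuous_comp _ _ _ z (fun z => (z.1,
      set_val z.2))).
      apply: for_continuous_pair; first exact: cvg_fst.
      by apply: for_continuous_comp; [exact: cvg_snd|exact: set_val_cts].
    exact: cH.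
  + by move=> x; rewrite H0.
  + by move=> x; rewrite H1.
  + by move=> x s; exact: Hb.
- move=> [l [[cl lb] /homotopic_real[H [cH H0 H1 Hb]]]].
  exists l, H; split => //.
  + by move=> x _; exact: cl.
  + by move=> x r _; exact: cH.
  + by move=> x _; exact: lb.
  + by move=> x r _; exact: Hb.
Qed.

End LiftOn.

Lemma for_continuous_comp2 (X Y Z W : topologicalType) (x : X)
    (f : X -> Y) (g : X -> Z) (h : Y * Z -> W) :
  {for x, continuous f} -> {for x, continuous g} ->
  {for (f x, g x), continuous h} -> {for x, continuous (fun y => h (f y, g y))}.
Proof.
move=> cf cg ch; apply: (@for_continuous_comp _ _ _ x (fun y => (f y,
  g y))) => //.
exact: for_continuous_pair.
Qed.

(** * One step of the Whitehead construction *)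

Section Join.
Variables (R : realType) (T A W Y : bspace) (t : T -> W) (iota : A -> Y).

(** These maps repeat the recursive clause of [wg], so that for [t := wg_map R iota n] the space
    [join_space] and the map [join_map] are convertible to the next stage. *)
Definition join_f (z : prod_space T A) : prod_space W A := (t z.1, z.2).
Definition join_g (z : prod_space T A) : prod_space T Y := (z.1, iota z.2).
Definition join_p (z : prod_space W A) : prod_space W Y := (z.1, iota z.2).
Definition join_q (z : prod_space T Y) : prod_space W Y := (t z.1, z.2).
Definition join_space : bspace := hpushout R join_f join_g.
Definition join_map : join_space ->
  prod_space W Y := hpushout_map join_p join_q.

Definition join_left (w : W) (a : A) : join_space :=
  hp_left R join_f join_g (w, a).
Definition join_cyl (x : T) (a : A) (s : unitI R) : join_space :=
  hp_cyl join_f join_g ((x, a), s).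
Definition join_right (x : T) (y : Y) : join_space :=
  hp_right R join_f join_g (x, y).

Lemma join_map_left w a : join_map (join_left w a) = (w, iota a).
Proof. by rewrite /join_map hpushout_mapE hpushout_rec_left. Qed.

Lemma join_map_cyl x a s : join_map (join_cyl x a s) = (t x, iota a).
Proof. by rewrite /join_map hpushout_mapE hpushout_rec_cyl. Qed.

Lemma join_map_right x y : join_map (join_right x y) = (t x, y).
Proof. by rewrite /join_map hpushout_mapE hpushout_rec_right. Qed.

Lemma join_space_ind (K : join_space -> Prop) :
  (forall w a, K (join_left w a)) -> (forall x a s, K (join_cyl x a s)) ->
  (forall x y, K (join_right x y)) -> forall z, K z.
Proof.
move=> Kl Kc Kr; apply: (@hpushout_ind _ _ _ _ _ _ K) => [[w a]|[x a] s|[x y]].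
- exact: Kl.
- exact: Kc.
- exact: Kr.
Qed.

Lemma base_join_left w a : base W w -> base A a ->
  base join_space (join_left w a).
Proof. by move=> Ww Aa; exists (w, a). Qed.

Hypotheses (mt : is_map t) (miota : is_map iota).

(** The reduced cylinder collapses the segment over the basepoint onto its left end, which is where
    [base] of the pushout is defined. *)
Lemma base_join_cyl x a s : base T x -> base A a ->
  base join_space (join_cyl x a s).
Proof.
move=> Tx Aa; have -> : join_cyl x a s = join_left (t x) a.
  exact: (@hp_cyl_base R _ _ _ join_f join_g (x, a)).
by apply: base_join_left => //; apply mt.2.
Qed.

Lemma base_join_right x a : base T x -> base A a ->
  base join_space (join_right x (iota a)).
Proof.
move=> Tx Aa; have -> : join_right x (iota a) = join_left (t x) a.
  exact: (@hp_right_base R _ _ _ join_f join_g (x, a)).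
by apply: base_join_left => //; apply mt.2.
Qed.

Lemma is_map_join_map : is_map join_map.
Proof.
split.
  move=> z; apply: (@hpushout_for_continuous _ _ _ _ join_f join_g _ join_map
    setT) => //.
  - exact: openT.
  - move=> [w a] _.
    rewrite (_ : _ \o _ = join_p); last by apply/funext => -[w' a'];
      exact: join_map_left.
    apply: for_continuous_pair; first exact: cvg_fst.
    by apply: for_continuous_comp; [exact: cvg_snd|exact: miota.1].
  - move=> [[x a] s] _.
    rewrite (_ : _ \o _ = fun z => (t z.1.1, iota z.1.2)); last first.
      by apply/funext => -[[x' a'] s']; exact: join_map_cyl.
    apply: for_continuous_pair.
      apply: for_continuous_comp; last exact: mt.1.
      by apply: for_continuous_comp; exact: cvg_fst.
    apply: for_continuous_comp; last exact: miota.1.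
    by apply: for_continuous_comp; [exact: cvg_fst|exact: cvg_snd].
  - move=> [x y] _.
    rewrite (_ : _ \o _ = join_q); last by apply/funext => -[x' y'];
      exact: join_map_right.
    apply: for_continuous_pair; last exact: cvg_snd.
    by apply: for_continuous_comp; [exact: cvg_fst|exact: mt.1].
move=> _ [[w a] [/= Ww Aa] <-].
by rewrite -/(join_left w a) join_map_left; split => //; exact: miota.2.
Qed.

Lemma for_continuous_join_left (X : topologicalType) (x : X) (w : X ->
  W) (a : X -> A) :
  {for x, continuous w} -> {for x, continuous a} ->
  {for x, continuous (fun y => join_left (w y) (a y))}.
Proof.
move=> cw ca; apply: (@for_continuous_comp2 _ _ _ _ x w a) => //.
exact: (@hp_piece_continuous _ _ _ _ join_f join_g LeftPiece).
Qed.

Lemma for_continuous_join_cyl (X : topologicalType) (x : X) (k : X -> T)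
    (a : X -> A) (s : X -> R) :
  {for x, continuous k} -> {for x, continuous a} -> {for x, continuous s} ->
  {for x, continuous (fun y => join_cyl (k y) (a y) (to_unitI (s y)))}.
Proof.
move=> ck ca cs.
apply: (@for_continuous_comp2 _ _ _ _ x (fun y => (k y,
  a y)) (fun y => to_unitI (s y))).
- exact: for_continuous_pair.
- by apply: for_continuous_comp; [exact: cs|exact: continuous_to_unitI].
- exact: (@hp_piece_continuous _ _ _ _ join_f join_g CylPiece).
Qed.

Lemma for_continuous_join_right (X : topologicalType) (x : X) (k : X ->
  T) (y : X -> Y) :
  {for x, continuous k} -> {for x, continuous y} ->
  {for x, continuous (fun x => join_right (k x) (y x))}.
Proof.
move=> ck cy; apply: (@for_continuous_comp2 _ _ _ _ x k y) => //.
exact: (@hp_piece_continuous _ _ _ _ join_f join_g RightPiece).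
Qed.

Lemma join_left_cyl x a s : s <= 0 ->
  join_cyl x a (to_unitI s) = join_left (t x) a.
Proof.
move=> s0; rewrite (_ : to_unitI s = I0 R); last first.
  by apply: val_inj; exact: clamp_le0.
exact: hp_cyl0.
Qed.

Lemma join_right_cyl x a s : 1 <= s ->
  join_cyl x a (to_unitI s) = join_right x (iota a).
Proof.
move=> s1; rewrite (_ : to_unitI s = I1 R); last first.
  by apply: val_inj; exact: clamp_ge1.
exact: hp_cyl1.
Qed.

(** The function [b] tells how far a point of [X] has travelled through the join. Up to 1 it rests
    in the left end, between 1 and 2 the homotopy [K] leads from [phi] to [t \o k], between 2 and 3
    the cylinder is crossed, between 3 and 4 the homotopy [H] leads from [iota \o l] to [psi], and
    from 4 on it rests in the right end. The lift [k] enters from 1 on and [l] up to 4, strictly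
    inside the regions where they are given. *)
Lemma lift_on_join (X : bspace) (phi : X -> W) (psi : X -> Y) (b : X -> R) :
  base Y `<=` iota @` base A ->
  is_map phi -> is_map psi -> continuous b ->
  lift_on R t phi [set x | 0 < b x] -> lift_on R iota psi [set x | b x < 5] ->
  @lift_on R X join_space (prod_space W Y) join_map
    (fun x => (phi x, psi x)) setT.
Proof.
move=> bYA [cphi bphi] [cpsi bpsi] cb.
move=> [k [K [ck cK K0 K1 bk bK]]] [l [H [cl cH H0 H1 bl bH]]].
rewrite /= in ck cK K0 K1 bk bK cl cH H0 H1 bl bH.
have max0 (u : R) : u <= 0 -> Num.max 0 u = 0 by move/max_idPl.
have max0' (u : R) : 0 <= u -> Num.max 0 u = u by move/max_idPr.
have max1 (u : R) : u <= 1 -> Num.max 1 u = 1 by move/max_idPl.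
have cbB (c : R) x : {for x, continuous (fun y => b y - c)}.
  by apply: cvgB; [exact: cb|exact: cvg_cst].
have cBb (c : R) x : {for x, continuous (fun y => c - b y)}.
  by apply: cvgB; [exact: cvg_cst|exact: cb].
exists (fun x => if b x <= 1 then join_left (phi x) (l x) else
  if b x <= 2 then join_left (K (x, 2 - b x)) (l x) else
  if b x <= 3 then join_cyl (k x) (l x) (to_unitI (b x - 2)) else
  if b x <= 4 then join_right (k x) (H (x, b x - 3)) else
  join_right (k x) (psi x)).
(* The two coordinates are deformed separately. The maximum makes the parameters of [K] and [H]
   start from their value in the lift and end at 1, where these homotopies reach [phi] and [psi]. *)
exists (fun z => (
  if b z.1 <= 1 then phi z.1 else K (z.1, Num.max (clamp z.2) (2 - b z.1)),
  if b z.1 <= 4 then H (z.1, Num.max (clamp z.2) (b z.1 - 3)) else psi z.1)).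
split.
- move=> x _.
  apply: for_continuous_if_le => [||b1|b1]; first exact: cb.
  + move=> b1; apply: for_continuous_join_left; first exact: cphi.
    by apply: cl => /=; lra.
  + apply: for_continuous_if_le => [||b2|b2]; first exact: cb.
    * move=> b2; apply: for_continuous_join_left; last by apply: cl => /=; lra.
      apply: (@for_continuous_comp2 _ _ _ _ x id); [exact: cvg_id|exact: cBb|].
      by apply: cK => /=; lra.
    * apply: for_continuous_if_le => [||b3|b3]; first exact: cb.
      - move=> b3; apply: for_continuous_join_cyl; last exact: cbB.
          by apply: ck => /=; lra.
        by apply: cl => /=; lra.
      - apply: for_continuous_if_le => [||b4|b4]; first exact: cb.
        + move=> b4; apply: for_continuous_join_right; first by apply: ck => /=;
            lra.
          apply: (@for_continuous_comp2 _ _ _ _ x id);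
            [exact: cvg_id|exact: cbB|].
          by apply: cH => /=; lra.
        + by apply: for_continuous_join_right; [apply: ck => /=;
            lra|exact: cpsi].
        + by congr join_right; rewrite b4 (_ : 4 - 3 = 1)// ?H1//=; lra.
      - rewrite b3 ifT; last lra.
        rewrite join_right_cyl; last lra.
        by congr join_right; rewrite (_ : 3 - 3 = 0)// ?H0//=; lra.
    * rewrite b2 ifT; last lra.
      rewrite join_left_cyl; last lra.
      by congr join_left; rewrite (_ : 2 - 2 = 0)// ?K0//=; lra.
  + rewrite b1 ifT; last lra.
    by congr join_left; rewrite (_ : 2 - 1 = 1)// ?K1//=; lra.
- move=> x r _.
  have cb1 : {for (x, r), continuous (fun z : X * R => b z.1)}.
    by apply: (@for_continuous_comp _ _ _ (x, r)); [exact: cvg_fst|exact: cb].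
  have cc : {for (x, r), continuous (fun z : X * R => clamp z.2)}.
    by apply: (@for_continuous_comp _ _ _ (x, r));
      [exact: cvg_snd|exact: continuous_clamp].
  apply: for_continuous_pair.
  + apply: (@for_continuous_if_le _ _ _ (x,
      r) (fun z => b z.1) 1 (fun z => phi z.1)) => //= [_|b1|b1].
    * by apply: (@for_continuous_comp _ _ _ (x, r));
        [exact: cvg_fst|exact: cphi].
    * apply: (@for_continuous_comp2 _ _ _ _ (x, r) fst); first exact: cvg_fst.
        apply: continuous_max => //.
        by apply: cvgB; [exact: cvg_cst|exact: cb1].
      by apply: cK => /=; lra.
    * have /andP[_ ?] := set_val_unitI (to_unitI r).
      by rewrite b1 (_ : 2 - 1 = 1) ?(max_idPr _)// ?K1//=; lra.
  + apply: (@for_continuous_if_le _ _ _ (x,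
      r) (fun z => b z.1) 4 _ (fun z => psi z.1)) => //= [b4|b4|b4].
    * apply: (@for_continuous_comp2 _ _ _ _ (x, r) fst); first exact: cvg_fst.
        apply: continuous_max => //.
        by apply: cvgB; [exact: cb1|exact: cvg_cst].
      by apply: cH => /=; lra.
    * by apply: (@for_continuous_comp _ _ _ (x, r));
        [exact: cvg_fst|exact: cpsi].
    * have /andP[_ ?] := set_val_unitI (to_unitI r).
      by rewrite b4 (_ : 4 - 3 = 1) ?(max_idPr _)// ?H1//=; lra.
- move=> x _ /=; rewrite clamp_le0//.
  case: (lerP (b x) 1) => b1.
    by rewrite join_map_left ifT ?max0 ?H0//; lra.
  case: (lerP (b x) 2) => b2.
    by rewrite join_map_left ifT ?(max0 (b x - 3)) ?max0' ?H0//; lra.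
  have -> : K (x, Num.max 0 (2 - b x)) = t (k x) by rewrite max0 ?K0//; lra.
  case: (lerP (b x) 3) => b3.
    by rewrite join_map_cyl ifT ?max0 ?H0//; lra.
  case: (lerP (b x) 4) => b4.
    by rewrite join_map_right max0'//; lra.
  by rewrite join_map_right.
- move=> x _ /=; rewrite clamp_ge1//; congr pair.
    by case: (lerP (b x) 1) => // b1; rewrite max1 ?K1//; lra.
  by case: (lerP (b x) 4) => // b4; rewrite max1 ?H1//; lra.
- move=> x _ xb.
  case: (lerP (b x) 1) => b1.
    by apply: base_join_left; [exact: bphi|apply: bl => //; lra].
  have kb : base T (k x) by apply: bk => //; lra.
  case: (lerP (b x) 2) => b2.
    by apply: base_join_left; [apply: bK => //; lra|apply: bl => //; lra].
  case: (lerP (b x) 3) => b3.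
    by apply: base_join_cyl => //; apply: bl => //; lra.
  case: (lerP (b x) 4) => b4.
    (* In the right end a basepoint is recognised through the gluing, hence in the form [iota a]
       with [a] in the base of [A]; [bYA] provides this form. *)
    have /bYA[a Aa <-] : base Y (H (x, b x - 3)) by apply: bH => //; lra.
    exact: base_join_right.
  have /bYA[a Aa <-] : base Y (psi x) by exact: bpsi.
  exact: base_join_right.
- move=> x r _ xb; split => /=.
    by case: (lerP (b x) 1) => b1; [exact: bphi|apply: bK => //; lra].
  by case: (lerP (b x) 4) => b4; [apply: bH => //; lra|exact: bpsi].
Qed.

End Join.

(** * Normal spaces *)

Lemma normal_space_set_type (R : realType) (X : topologicalType) (D : set X) :
  closed D -> normal_space X -> normal_space (set_type D).
Proof.
move=> cD /(@normal_openP R) nX; apply/(@normal_openP R) => A B cA cB AB0.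
(* Since [D] is closed, its closed subsets are closed in [X] and can be separated there. *)
have ext (E : set D) : closed E -> closed (set_val @` E).
  move=> cE; have [W oW WE] : open (~` E) by exact: closed_openC.
  have -> : set_val @` E = D `&` ~` W.
    apply/seteqP; split => [_ [x Ex <-]|x [Dx Wx]].
      split; first exact: set_valP.
      by move=> Wx; have : (~` E) x by rewrite -WE.
    exists (exist _ x (mem_set Dx)) => //; apply: contrapT => nE.
    by have : (~` E) (exist _ x (mem_set Dx)) by []; rewrite -WE.
  by apply: closedI => //; exact: open_closedC.
have [|U [V [oU oV AU BV UV0]]] := nX _ _ (ext _ cA) (ext _ cB).
  rewrite -subset0 => _ [[x Ax <-] [y By /val_inj yx]].
  by rewrite yx in By; have : (A `&` B) x by []; rewrite AB0.
exists (set_val @^-1` U), (set_val @^-1` V); split.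
- by exists U.
- by exists V.
- by move=> x Ax; apply: AU; exists x.
- by move=> x Bx; apply: BV; exists x.
- by rewrite -preimage_setI UV0 preimage_set0.
Qed.

Lemma normal_urysohn (R : realType) (X : topologicalType) (C D : set X) :
  normal_space X -> closed C -> closed D -> C `&` D = set0 ->
  exists u : X -> R,
    [/\ continuous u, forall x, C x -> u x = 0 & forall x, D x -> u x = 1].
Proof.
move=> /(@normal_separatorP R) nX cC cD CD0.
have /(@uniform_separatorP _ R)[u [cu _ uC uD]] := nX _ _ cC cD CD0.
exists u; split => // x Ex; [apply: uC|apply: uD]; by exists x.
Qed.

(** * From open covers to Whitehead lifts *)

Section WhiteheadLift.
Variables (R : realType) (A Y : bspace) (iota : A -> Y).
Hypotheses (miota : is_map iota) (bYA : base Y `<=` iota @` base A) (a0 : A).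

Lemma is_map_diagonal n : is_map (@diagonal_map Y n).
Proof.
elim: n => [|n [cd bd]]; first by split => // y; exact: cvg_id.
split => [y|y by_]; last by split => //; exact: bd.
by apply: for_continuous_pair; [exact: cd|exact: cvg_id].
Qed.

Lemma is_map_wg n : is_map (wg_map R iota n).
Proof.
elim: n => [//|n mt].
exact: (@is_map_join_map R _ _ _ _ _ _ mt miota).
Qed.

(** Provides the default value that [lift_on_interior] asks for. *)
Lemma wg_inhabited n : wg_space R iota n.
Proof.
case: n => [//|n].
exact: (join_left R (wg_map R iota n) iota (diagonal_map n (iota a0)) a0).
Qed.

Lemma is_map_comp (X1 X2 X3 : bspace) (h : X1 -> X2) (k : X2 -> X3) :
  is_map h -> is_map k -> is_map (k \o h).
Proof.
move=> [ch bh] [ck bk]; split => [x|x /bh/bk//].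
by apply: (@for_continuous_comp _ _ _ x h); [exact: ch|exact: ck].
Qed.

Lemma lift_on_wg n (X : bspace) (f : X -> Y) (U : nat -> set X) :
  is_map f -> normal_space X -> (forall i, (i <= n)%N -> open (U i)) ->
  (forall x, exists2 i, (i <= n)%N & U i x) ->
  (forall i, (i <= n)%N -> lift_on R iota f (U i)) ->
  lift_on R (wg_map R iota n) (@diagonal_map Y n \o f) setT.
Proof.
elim: n X f U => [|n IH] X f U mf nX oU cU lU.
  apply: lift_onW (lU 0%N isT) => x _.
  by have [i] := cU x; rewrite leqn0 => /eqP ->.
pose V := \bigcup_(i in [set i | (i <= n)%N]) U i.
have oV : open V by apply: bigcup_open => i ni; apply: oU; exact: leqW.
have [|||u [cu uV uU]] := @normal_urysohn R X (~` V) (~` U n.+1) nX.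
- exact: open_closedC.
- exact/open_closedC/oU.
- rewrite -setCU -subset0 => x; apply => /=.
  have [i] := cU x; rewrite leq_eqVlt => /orP[/eqP-> |ni Uix]; first by right.
  by left; exists i.
(* The range is stretched to run from -1 outside [V] to 6 outside [U n.+1]. Hence [0 <= b x] forces
   [V x], and [b x < 5] forces [U n.+1 x], as [lift_on_join] demands. *)
pose b x := 7 * u x - 1.
have cb : continuous b.
  move=> x; apply: cvgB; last exact: cvg_cst.
  by apply: cvgM; [exact: cvg_cst|exact: cu].
refine (@lift_on_join R (wg_space R iota n) A (power Y n) Y (wg_map R iota n)
  iota (is_map_wg n) X (@diagonal_map Y n \o f) f b _ _ _ _ _ _) => //.
- exact: (is_map_comp mf (is_map_diagonal n)).
(* The induction hypothesis needs a normal space. It is applied to the closed set [D], and the lift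
   is then restricted to the open set where [b] is positive, which lies in the interior of [D]. *)
- pose D := [set x | 0 <= b x].
  have cD : closed D.
    rewrite (_ : D = b @^-1` [set r | 0 <= r])//.
    by apply: preimage_closed => //; exact: closed_ge.
  have : lift_on R (wg_map R iota n)
      (@diagonal_map Y n \o (f \o @set_val X D : subspace_of D -> Y)) setT.
    apply: (IH (subspace_of D) _ (fun i => set_val @^-1` U i)).
    + apply: (@is_map_comp (subspace_of D) X Y) => //.
      by split => // x; exact: set_val_cts.
    + exact: (@normal_space_set_type R).
    + by move=> i ni; exists (U i) => //; apply: oU; exact: leqW.
    + move=> x; have : V (set_val x).
        apply: contrapT => /uV ux;
          have : 0 <= b (set_val x) by exact: (set_valP x).
        by rewrite /b ux; lra.
      by move=> [i ni Uix]; exists i.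
    + move=> i ni; apply: lift_on_comp (lU i (leqW ni)) => // x _.
      exact: set_val_cts.
  move=> /lift_on_setTP[l [ml hl]].
  apply: (@lift_onW _ _ _ _ _ _ D°); last first.
    exact: (@lift_on_interior _ _ _ _ _ _ _ (wg_inhabited n) l).
  rewrite -open_subsetE => [x /=|]; first exact: ltW.
  by apply: (@open_comp _ _ b [set r | 0 < r]) => //; exact: open_gt.
- apply: lift_onW (lU n.+1 (leqnn _)) => x /= bx; apply: contrapT => /uU ux.
  by move: bx; rewrite /b ux; lra.
Qed.

End WhiteheadLift.

(** * Defining functions and sets on the join by pieces *)

Section JoinRec.
Variables (R : realType) (T A W Y : bspace) (t : T -> W) (iota : A -> Y).
Local Notation J := (join_space R t iota).
Local Notation jl := (join_left R t iota).
Local Notation jc := (@join_cyl R T A W Y t iota).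
Local Notation jr := (join_right R t iota).

Section Rec.
Variables (Z : Type) (p : W -> A -> Z) (m : T -> A -> R -> Z) (q : T -> Y -> Z).

Definition join_rec : J -> Z :=
  hpushout_rec (fun z : prod_space W A => p z.1 z.2)
    (fun z : prod_space T A * unitI R => m z.1.1 z.1.2 (set_val z.2))
    (fun z : prod_space T Y => q z.1 z.2).

Hypothesis m0 : forall x a, m x a 0 = p (t x) a.
Hypothesis m1 : forall x a, m x a 1 = q x (iota a).
Hypothesis mb : forall x a s, base T x -> base A a -> m x a s = p (t x) a.

Lemma join_rec_left w a : join_rec (jl w a) = p w a.
Proof.
apply: hpushout_rec_left => [[x b]|[x b]|[x b] s [/= ? ?]] /=.
- exact: m0.
- exact: m1.
- exact: mb.
Qed.

Lemma join_rec_cyl x a s : join_rec (jc x a s) = m x a (set_val s).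
Proof.
apply: hpushout_rec_cyl => [[x' b]|[x' b]|[x' b] s' [/= ? ?]] /=.
- exact: m0.
- exact: m1.
- exact: mb.
Qed.

Lemma join_rec_right x y : join_rec (jr x y) = q x y.
Proof.
apply: hpushout_rec_right => [[x' b]|[x' b]|[x' b] s' [/= ? ?]] /=.
- exact: m0.
- exact: m1.
- exact: mb.
Qed.

End Rec.

Lemma join_open (V : set J) :
  open [set z : W * A | V (jl z.1 z.2)] ->
  open [set z : T * A * unitI R | V (jc z.1.1 z.1.2 z.2)] ->
  open [set z : T * Y | V (jr z.1 z.2)] -> open V.
Proof.
move=> ol oc or; apply: hpushout_open.
- by rewrite (_ : _ @^-1` _ = [set z : W * A | V (jl z.1 z.2)])//; apply/seteqP;
    split=> -[].
- by rewrite (_ : _ @^-1` _ = [set z :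
    T * A * unitI R | V (jc z.1.1 z.1.2 z.2)])//;
    apply/seteqP; split=> -[[]].
- by rewrite (_ : _ @^-1` _ = [set z : T * Y | V (jr z.1 z.2)])//; apply/seteqP;
    split=> -[].
Qed.

Lemma join_for_continuous (Z : topologicalType) (h : J -> Z) (V : set J) :
  open V ->
  (forall w a, V (jl w a) -> {for (w, a),
    continuous (fun z : W * A => h (jl z.1 z.2))}) ->
  (forall x a s, V (jc x a s) ->
    {for (x, a, s), continuous (fun z : T * A * unitI R =>
      h (jc z.1.1 z.1.2 z.2))}) ->
  (forall x y, V (jr x y) -> {for (x, y),
    continuous (fun z : T * Y => h (jr z.1 z.2))}) ->
  forall z, V z -> {for z, continuous h}.
Proof.
move=> oV cl cc cr; apply: hpushout_for_continuous => //.
- move=> [w a] /cl; congr (continuous_at _ _).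
  by apply/funext => -[].
- move=> [[x a] s] /cc; congr (continuous_at _ _).
  by apply/funext => -[[]].
- move=> [x y] /cr; congr (continuous_at _ _).
  by apply/funext => -[].
Qed.

Lemma join_prod_continuous (Z : topologicalType) (h : J * R -> Z) :
  continuous (fun z : W * A * R => h (jl z.1.1 z.1.2, z.2)) ->
  continuous (fun z : T * A * unitI R * R => h (jc z.1.1.1 z.1.1.2 z.1.2,
    z.2)) ->
  continuous (fun z : T * Y * R => h (jr z.1.1 z.1.2, z.2)) -> continuous h.
Proof.
move=> cl cc cr; apply: hpushout_prod_continuous.
- by rewrite (_ : (fun _ => _) = (fun z : W * A * R => h (jl z.1.1 z.1.2,
    z.2)))//;
    apply/funext => -[[]].
- by rewrite (_ : (fun _ => _) =
    (fun z : T * A * unitI R * R => h (jc z.1.1.1 z.1.1.2 z.1.2, z.2)))//;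
    apply/funext => -[[[]]].
- by rewrite (_ : (fun _ => _) = (fun z : T * Y * R => h (jr z.1.1 z.1.2,
    z.2)))//;
    apply/funext => -[[]].
Qed.

End JoinRec.

(** * Retractions near the basepoint *)

(* The retraction [(alpha, sigma)] of [X * R] onto the union of [X * {0}] and
   [base X * [0, 1]] given by the homotopy extension property of [base X]. *)
Record ndr_data (R : realType) (X : bspace) (alpha : X * R -> X)
    (sigma : X * R -> R) : Prop := NdrData {
  ndr_cts : continuous alpha;
  ndr_height_cts : continuous sigma;
  ndr0 : forall x (r : R), r <= 0 -> alpha (x, r) = x;
  ndr_height0 : forall x (r : R), r <= 0 -> sigma (x, r) = 0;
  ndr_height_gt0 : forall x (r : R), 0 < sigma (x, r) -> base X (alpha (x, r));
  ndr_base : forall x (r : R), base X x -> alpha (x, r) = x;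
  ndr_height_base : forall x (r : R), base X x -> sigma (x, r) = clamp r
}.

Lemma is_object_ndr (R : realType) (c : category) (X : bspace) :
  is_object R c X -> exists alpha, exists sigma, @ndr_data R X alpha sigma.
Proof.
case: c => /= [[_ X0]|[x0 X0 [cx0 hep]]].
  (* Nothing has to be retracted when the base is empty: the deformation is constant and the height
     stays zero. *)
  exists fst, (fun=> 0); split => [z|z|//|//|x r|//|x r] /=.
  - exact: cvg_fst.
  - exact: cvg_cst.
  - by rewrite ltxx.
  - by rewrite X0.
(* The homotopy extension property is used with [E] itself as target and with the two inclusions
   into [E] as data. The extension [H] is then a retraction of the cylinder onto [E], and [alpha]
   and [sigma] are its coordinates. *)
pose E := [set z : X * unitI R | z.2 = I0 R \/ z.1 = x0].
have E0 x : (x, I0 R) \in E by apply/mem_set; left.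
have Eb (b : [set x0]) s : (set_val b, s) \in E.
  by apply/mem_set; right; exact: (set_valP b).
pose f0 x : E := exist _ (x, I0 R) (E0 x).
pose h0 (z : [set x0] * unitI R) : E := exist _ (set_val z.1, z.2) (Eb z.1 z.2).
have [||| H [cH H0 Hb]] := hep (set_type E) f0 h0.
- apply: continuous_set_type => x; apply: for_continuous_pair;
    first exact: cvg_id.
  exact: cvg_cst.
- apply: continuous_set_type => z.
  apply: (@for_continuous_pair _ _ _ z (fun z => set_val z.1) snd);
    last exact: cvg_snd.
  by apply: for_continuous_comp; [exact: cvg_fst|exact: set_val_cts].
- by move=> b; apply: val_inj.
pose K (z : X * R) : X * unitI R := set_val (H (z.1, to_unitI z.2)).
have cK : continuous K.
  move=> z; apply: (@for_continuous_comp _ _ _ z (fun z => H (z.1,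
    to_unitI z.2)));
    last exact: set_val_cts.
  apply: (@for_continuous_comp2 _ _ _ _ z fst (@to_unitI R \o snd));
    first exact: cvg_fst.
    by apply: for_continuous_comp; [exact: cvg_snd|exact: continuous_to_unitI].
  exact: cH.
have K0 x r : r <= 0 -> K (x, r) = (x, I0 R).
  move=> r0; rewrite /K /= (_ : to_unitI r = I0 R) ?H0//.
  by apply: val_inj; exact: clamp_le0.
have Kb x r : base X x -> K (x, r) = (x, to_unitI r).
  rewrite X0 => xx0; have xb : x \in [set x0] by exact/mem_set.
  by rewrite /K /= (Hb (exist _ x xb)).
exists (fun z => (K z).1), (fun z => set_val (K z).2); split => //=.
- by move=> z; apply: (@for_continuous_comp _ _ _ z K);
    [exact: cK|exact: cvg_fst].
- move=> z; apply: (@for_continuous_comp _ _ _ z (fun z => (K z).2));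
    last exact: set_val_cts.
  by apply: (@for_continuous_comp _ _ _ z K); [exact: cK|exact: cvg_snd].
- by move=> x r r0; rewrite K0.
- by move=> x r r0; rewrite K0.
- move=> x r; rewrite X0; have [-> /=|//] : E (K (x, r)) by exact: set_valP.
  by rewrite ltxx.
- by move=> x r bx; rewrite Kb.
- by move=> x r bx; rewrite Kb.
Qed.

(** Switches the retraction of [Y] on only past the middle of the cylinder, and fully at the right
    end. *)
Definition ramp (R : realType) (s : R) : R := Num.max 0 (2 * s - 1).

Lemma ramp_le (R : realType) (s : R) : s <= 1 / 2 -> ramp s = 0.
Proof. by move=> s2; apply/max_idPl; lra. Qed.

Lemma ramp1 (R : realType) : ramp (1 : R) = 1.
Proof. by rewrite /ramp mulr1 (_ : 2 - 1 = 1) ?(max_idPr _)//; lra. Qed.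

Lemma continuous_ramp (R : realType) : continuous (@ramp R).
Proof.
move=> s.
have c0 : {for s, continuous (fun=> 0 : R)} by exact: cvg_cst.
have c1 : {for s, continuous (fun s : R => 2 * s - 1)}.
  apply: cvgB; last exact: cvg_cst.
  by apply: cvgM; [exact: cvg_cst|exact: cvg_id].
exact: (continuous_max c0 c1).
Qed.

(** * The left half of the join and its pointed lift *)

Section JoinCover.
Variables (R : realType) (T A W Y : bspace) (t : T -> W) (iota : A -> Y).
Variables (al : A * R -> A) (sg : A * R -> R) (al' : Y * R -> Y) (sg' : Y * R ->
  R).
Hypotheses (ndrA : ndr_data al sg) (ndrY : ndr_data al' sg').
Hypotheses (miota : is_map iota) (a0 : A).
Hypotheses (bA : base A `<=` [set a0]) (bY : base Y `<=` [set iota a0]).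
Local Notation J := (join_space R t iota).
Local Notation jm := (@join_map R T A W Y t iota).
Local Notation jl := (join_left R t iota).
Local Notation jc := (@join_cyl R T A W Y t iota).
Local Notation jr := (join_right R t iota).

(** At height [s] the retraction of [A] runs for time [1 - s]: in full at the left end, and not at
    all at the right end, where the retraction of [Y] takes over. *)
Let al_cyl (a : A) (s : R) : Y := iota (al (a, 1 - s)).
Let V_cyl (a : A) (s : R) : Prop :=
  [\/ s < 1 / 2, 0 < sg (a, 1 - s) | 0 < sg' (al_cyl a s, ramp s)].

(* The left half of the cylinder, enlarged by the points that the retractions
   of [A] and [Y] send to the basepoint. *)
Definition near_left : set J :=
  join_rec (fun _ _ => True) (fun _ => V_cyl) (fun _ y => 0 < sg' (y, 1)).

(** [V0], [V1] and [Vb] are the compatibilities with the gluing required by [join_rec]; the triples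
    for the lift, the deformation and the right half below play the same part. *)
Let V0 (a : A) : V_cyl a 0 = True.
Proof. by apply/propext; split => // _; apply: Or31; lra. Qed.

Let V1 (a : A) : V_cyl a 1 = is_true (0 < sg' (iota a, 1)).
Proof.
apply/propext; rewrite /V_cyl /al_cyl subrr ramp1 (ndr0 ndrA)// (ndr_height0
  ndrA)//.
by split => [[||//]|]; [lra|rewrite ltxx|exact: Or33].
Qed.

Let Vb (a : A) s : base A a -> V_cyl a s = True.
Proof.
move=> Aa; apply/propext; split => // _; rewrite /V_cyl /al_cyl.
(* On the base, the retraction of [A] has positive height if [s < 1], and that of [Y] has positive
   height from there on. *)
have [s1|s1] := ltP s 1.
  by apply: Or32; rewrite (ndr_height_base ndrA)//; apply: clamp_gt0; lra.
apply: Or33; rewrite (ndr_base ndrA)// (ndr_height_base ndrY);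
  last exact: miota.2.
by apply: clamp_gt0; rewrite lt_max; apply/orP; right; lra.
Qed.

Lemma near_left_left w a : near_left (jl w a) = True.
Proof.
by apply: (join_rec_left (p := fun _ _ => True)) => *;
  [exact: V0|exact: V1|exact: Vb].
Qed.

Lemma near_left_cyl x a s : near_left (jc x a s) = V_cyl a (set_val s).
Proof.
by apply: (join_rec_cyl (m := fun _ => V_cyl)) => *;
  [exact: V0|exact: V1|exact: Vb].
Qed.

Lemma near_left_cyl_base x a s : base A a -> near_left (jc x a s).
Proof. by move=> Aa; rewrite near_left_cyl Vb. Qed.

Lemma near_left_right x y : near_left (jr x y) = is_true (0 < sg' (y, 1)).
Proof.
by apply: (join_rec_right (q := fun _ y => is_true (0 < sg' (y, 1)))) => *;
  [exact: V0|exact: V1|exact: Vb].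
Qed.

Let cts_height (z : T * A * unitI R) :
  {for z, continuous (fun z : T * A * unitI R => set_val z.2)}.
Proof.
by apply: (@for_continuous_comp _ _ _ z snd);
  [exact: cvg_snd|exact: set_val_cts].
Qed.

Let cts_cyl_a (z : T * A * unitI R) :
  {for z, continuous (fun z : T * A * unitI R => al (z.1.2, 1 - set_val z.2))}.
Proof.
apply: (@for_continuous_comp2 _ _ _ _ z (fun z => z.1.2)
  (fun z => 1 - set_val z.2)).
- by apply: for_continuous_comp; [exact: cvg_fst|exact: cvg_snd].
- apply: cvgB; first exact: cvg_cst.
  exact: cts_height.
- exact: (ndr_cts ndrA).
Qed.

Let open_gt0 (X : topologicalType) (h : X -> R) (c : R) : continuous h ->
  open [set x | c < h x].
Proof.
by move=> ch; apply: (@open_comp _ _ h [set r | c < r]) => //;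
  exact: open_gt.
Qed.

Let open_lt0 (X : topologicalType) (h : X -> R) (c : R) : continuous h ->
  open [set x | h x < c].
Proof.
by move=> ch; apply: (@open_comp _ _ h [set r | r < c]) => //;
  exact: open_lt.
Qed.

Lemma open_near_left : open near_left.
Proof.
apply: join_open.
- rewrite (_ : mkset _ = setT); first exact: openT.
  by apply/seteqP; split => // z _ /=; rewrite near_left_left.
- rewrite (_ : mkset _ = [set z : T * A * unitI R | set_val z.2 < 1 / 2] `|`
    ([set z | 0 < sg (z.1.2, 1 - set_val z.2)] `|`
    [set z | 0 < sg' (al_cyl z.1.2 (set_val z.2), ramp (set_val z.2))]));
      last first.
    apply/seteqP; split => z /=; rewrite near_left_cyl.
      by move=> [|H|H]; [left|right; left|right; right].
    by move=> [H|[H|H]]; [exact: Or31|exact: Or32|exact: Or33].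
  apply: openU; [|apply: openU].
  + by apply: open_lt0 => z; exact: cts_height.
  + apply: open_gt0 => z.
    apply: (@for_continuous_comp2 _ _ _ _ z (fun z => z.1.2)
      (fun z => 1 - set_val z.2)).
    * by apply: for_continuous_comp; [exact: cvg_fst|exact: cvg_snd].
    * apply: cvgB; first exact: cvg_cst.
      exact: cts_height.
    * exact: (ndr_height_cts ndrA).
  + apply: open_gt0 => z.
    apply: (@for_continuous_comp2 _ _ _ _ z (fun z =>
      al_cyl z.1.2 (set_val z.2))
      (fun z => ramp (set_val z.2))).
    * apply: (@for_continuous_comp _ _ _ z (fun z => al (z.1.2,
        1 - set_val z.2))).
        exact: cts_cyl_a.
      exact: miota.1.
    * apply: (@for_continuous_comp _ _ _ z (fun z => set_val z.2)).
        exact: cts_height.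
      exact: continuous_ramp.
    * exact: (ndr_height_cts ndrY).
- rewrite (_ : mkset _ = [set z : T * Y | 0 < sg' (z.2, 1)]); last first.
    by apply/seteqP; split => z /=; rewrite near_left_right.
  apply: open_gt0 => z.
  apply: (@for_continuous_comp2 _ _ _ _ z snd (fun=> 1 : R));
    first exact: cvg_snd.
    exact: cvg_cst.
  exact: (ndr_height_cts ndrY).
Qed.

(** The formula may jump at height 1/2, but not at points of [near_left], where [al] has then
    reached the basepoint [a0]. *)
Definition near_left_lift : J -> A :=
  join_rec (fun _ a => al (a, 1))
    (fun _ a s => if s <= 1 / 2 then al (a, 1 - s) else a0) (fun _ _ => a0).

Let L0 (a : A) : (if (0 : R) <= 1 / 2 then al (a, 1 - 0) else a0) = al (a, 1).
Proof. by rewrite ifT ?subr0//; lra. Qed.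

Let L1 (a : A) : (if (1 : R) <= 1 / 2 then al (a, 1 - 1) else a0) = a0.
Proof. by rewrite ifF//; apply/negbTE; rewrite -ltNge; lra. Qed.

Let Lb (a : A) (s : R) : base A a ->
  (if s <= 1 / 2 then al (a, 1 - s) else a0) = al (a, 1).
Proof.
by move=> Aa; rewrite !(ndr_base ndrA)//; case: ifP => // _;
  rewrite (bA Aa).
Qed.

Lemma near_left_lift_left w a : near_left_lift (jl w a) = al (a, 1).
Proof.
by apply: (join_rec_left (p := fun _ a => al (a, 1))) => *;
  [exact: L0|exact: L1|exact: Lb].
Qed.

Lemma near_left_lift_cyl x a s : near_left_lift (jc x a s) =
  if set_val s <= 1 / 2 then al (a, 1 - set_val s) else a0.
Proof.
by apply: (join_rec_cyl (m := fun _ a s => if s <= 1 / 2 then al (a,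
  1 - s) else a0)) => *;
  [exact: L0|exact: L1|exact: Lb].
Qed.

Lemma near_left_lift_right x y : near_left_lift (jr x y) = a0.
Proof.
by apply: (join_rec_right (q := fun _ _ => a0)) => *;
  [exact: L0|exact: L1|exact: Lb].
Qed.

Lemma near_left_lift_cts z : near_left z -> {for z, continuous near_left_lift}.
Proof.
move: z; apply: (join_for_continuous open_near_left).
- move=> w a _; rewrite (_ : (fun _ => _) = fun z : W * A => al (z.2, 1));
    last first.
    by apply/funext => -[w' a']; rewrite near_left_lift_left.
  apply: (@for_continuous_comp2 _ _ _ _ (w, a) snd (fun=> 1 : R));
    first exact: cvg_snd.
    exact: cvg_cst.
  exact: (ndr_cts ndrA).
- move=> x a s; rewrite near_left_cyl => Vas.
  rewrite (_ : (fun _ => _) = fun z : T * A * unitI R =>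
      if set_val z.2 <= 1 / 2 then al (z.1.2, 1 - set_val z.2) else a0);
        last first.
    by apply/funext => -[[x' a'] s']; rewrite near_left_lift_cyl.
  apply: (@for_continuous_if_le _ _ _ (x, a, s) (fun z => set_val z.2) (1 / 2)
    (fun z => al (z.1.2, 1 - set_val z.2)) (fun=> a0)) => /= [|_|_|s2].
  + exact: cts_height.
  + exact: cts_cyl_a.
  + exact: cvg_cst.
  (* At height exactly 1/2 the first alternative fails, and so does the third because [ramp]
     vanishes there. The second one says that [al] has arrived in the base. *)
  + case: Vas => [|sg0|]; rewrite s2.
    * by rewrite ltxx.
    * by apply: bA; rewrite -s2; exact: (ndr_height_gt0 ndrA).
    * by rewrite ramp_le// (ndr_height0 ndrY)// ltxx.
- move=> x y _; rewrite (_ : (fun _ => _) = fun=> a0); first exact: cvg_cst.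
  by apply/funext => -[x' y']; rewrite near_left_lift_right.
Qed.

(* Deforms the last coordinate of [join_map] (at time [0]) into a map which
   agrees with [iota \o near_left_lift] on [near_left] (at time [1]). *)
Let Th (z : J * R) : Y :=
  join_rec (fun _ a => iota (al (a, z.2)))
    (fun _ a s => al' (iota (al (a, z.2 * (1 - s))), z.2 * ramp s))
    (fun _ y => al' (y, z.2)) z.1.

Let Th0 (a : A) (r : R) :
  al' (iota (al (a, r * (1 - 0))), r * ramp 0) = iota (al (a, r)).
Proof. by rewrite subr0 mulr1 ramp_le ?mulr0 ?(ndr0 ndrY)//; lra. Qed.

Let Th1 (a : A) (r : R) :
  al' (iota (al (a, r * (1 - 1))), r * ramp 1) = al' (iota a, r).
Proof. by rewrite subrr mulr0 ramp1 mulr1 (ndr0 ndrA). Qed.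

Let Thb (a : A) (r s : R) : base A a ->
  al' (iota (al (a, r * (1 - s))), r * ramp s) = iota (al (a, r)).
Proof.
by move=> Aa; rewrite !(ndr_base ndrA)// (ndr_base ndrY)//; exact: miota.2.
Qed.

Let Th_left w a r : Th (jl w a, r) = iota (al (a, r)).
Proof.
by apply: (join_rec_left (p := fun _ a => iota (al (a, r)))) => *;
  [exact: Th0|exact: Th1|exact: Thb].
Qed.

Let Th_cyl x a s r : Th (jc x a s, r) =
  al' (iota (al (a, r * (1 - set_val s))), r * ramp (set_val s)).
Proof.
by apply: (join_rec_cyl
    (m := fun _ a s => al' (iota (al (a, r * (1 - s))), r * ramp s))) => *;
  [exact: Th0|exact: Th1|exact: Thb].
Qed.

Let Th_right x y r : Th (jr x y, r) = al' (y, r).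
Proof.
by apply: (join_rec_right (q := fun _ y => al' (y, r))) => *;
  [exact: Th0|exact: Th1|exact: Thb].
Qed.

Let Th_cts : continuous Th.
Proof.
apply: join_prod_continuous.
- rewrite (_ : (fun _ => _) = fun z : W * A * R => iota (al (z.1.2, z.2)));
    last first.
    by apply/funext => -[[w a] r]; rewrite Th_left.
  move=> z; apply: (@for_continuous_comp _ _ _ z (fun z => al (z.1.2, z.2))).
    apply: (@for_continuous_comp2 _ _ _ _ z (fun z => z.1.2) snd).
    + by apply: for_continuous_comp; [exact: cvg_fst|exact: cvg_snd].
    + exact: cvg_snd.
    + exact: (ndr_cts ndrA).
  exact: miota.1.
- rewrite (_ : (fun _ => _) = fun z : T * A * unitI R * R =>
    al' (iota (al (z.1.1.2, z.2 * (1 - set_val z.1.2))),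
      z.2 * ramp (set_val z.1.2)));
    last by apply/funext => -[[[x a] s] r]; rewrite Th_cyl.
  move=> z.
  have cs : {for z, continuous (fun z : T * A * unitI R * R => set_val z.1.2)}.
    apply: (@for_continuous_comp _ _ _ z (fun z => z.1.2));
      last exact: set_val_cts.
    by apply: for_continuous_comp; [exact: cvg_fst|exact: cvg_snd].
  apply: (@for_continuous_comp2 _ _ _ _ z
    (fun z => iota (al (z.1.1.2, z.2 * (1 - set_val z.1.2))))
    (fun z => z.2 * ramp (set_val z.1.2))).
  + apply: (@for_continuous_comp _ _ _ z (fun z => al (z.1.1.2,
      z.2 * (1 - set_val z.1.2))));
      last exact: miota.1.
    apply: (@for_continuous_comp2 _ _ _ _ z (fun z => z.1.1.2)
      (fun z => z.2 * (1 - set_val z.1.2))).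
    * apply: (@for_continuous_comp _ _ _ z (fun z => z.1.1));
        last exact: cvg_snd.
      by apply: for_continuous_comp; exact: cvg_fst.
    * apply: cvgM; first exact: cvg_snd.
      by apply: cvgB; [exact: cvg_cst|exact: cs].
    * exact: (ndr_cts ndrA).
  + apply: cvgM; first exact: cvg_snd.
    by apply: (@for_continuous_comp _ _ _ z (fun z => set_val z.1.2));
      [exact: cs|exact: continuous_ramp].
  + exact: (ndr_cts ndrY).
- rewrite (_ : (fun _ => _) = fun z : T * Y * R => al' (z.1.2, z.2));
    last first.
    by apply/funext => -[[x y] r]; rewrite Th_right.
  move=> z; apply: (@for_continuous_comp2 _ _ _ _ z (fun z => z.1.2) snd).
  + by apply: for_continuous_comp; [exact: cvg_fst|exact: cvg_snd].
  + exact: cvg_snd.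
  + exact: (ndr_cts ndrY).
Qed.

Lemma base_near_left : base J `<=` near_left.
Proof. by move=> _ [[w a] _ <-]; rewrite -/(jl w a) near_left_left. Qed.

Lemma lift_on_near_left : @lift_on R J A Y iota (fun z => (jm z).2) near_left.
Proof.
(* Time is reversed, since the homotopy of a lift starts at the lift and [Th] ends there. *)
exists near_left_lift, (fun z => Th (z.1, 1 - z.2)); split.
- exact: near_left_lift_cts.
- move=> z r _; apply: (@for_continuous_comp2 _ _ _ _ (z,
    r) fst (fun z => 1 - z.2)).
  + exact: cvg_fst.
  + by apply: cvgB; [exact: cvg_cst|exact: cvg_snd].
  + exact: Th_cts.
- move=> z; change (near_left z -> Th (z, 1 - 0) = iota (near_left_lift z)).
  rewrite subr0; move: z; apply: join_space_ind => [w a _|x a s|x y].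
  + by rewrite Th_left near_left_lift_left.
  + rewrite near_left_cyl Th_cyl near_left_lift_cyl (mul1r (1 - _))
      (mul1r (ramp _)) => Vas.
    case: ifP => [s2|/negbT]; first by rewrite ramp_le// (ndr0 ndrY).
    (* Past the middle the lift is [a0]. If [al] has reached the base, [al'] keeps the image of that
       point fixed; otherwise [al'] itself has reached the base of [Y]. *)
    rewrite -ltNge => s2; case: Vas => [|/(ndr_height_gt0 ndrA)
      Aa|/(ndr_height_gt0 ndrY)].
    * by rewrite ltNge (ltW s2).
    * by have := miota.2 _ Aa; rewrite (bA Aa) => /(ndr_base ndrY).
    * by move/bY.
  + by rewrite near_left_right Th_right near_left_lift_right =>
      /(ndr_height_gt0 ndrY)/bY.
- move=> z; change (near_left z -> Th (z, 1 - 1) = (jm z).2).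
  rewrite subrr; move: z; apply: join_space_ind => [w a|x a s|x y] _.
  + by rewrite Th_left join_map_left (ndr0 ndrA).
  + by rewrite Th_cyl join_map_cyl !mul0r (ndr0 ndrA)// (ndr0 ndrY).
  + by rewrite Th_right join_map_right (ndr0 ndrY).
- move=> _ _ [[w a] [_ /= Aa] <-].
  by rewrite -/(jl w a) near_left_lift_left (ndr_base ndrA).
- move=> _ r _ [[w a] [_ /= Aa] <-].
  change (base Y (Th (jl w a, 1 - r))).
  by rewrite Th_left (ndr_base ndrA)//; exact: miota.2.
Qed.

End JoinCover.

(** * The right half of the join and its projection to the previous stage *)

Section JoinRight.
Variables (R : realType) (T A W Y : bspace) (t : T -> W) (iota : A ->
  Y) (x0 : T).
Hypotheses (miota : is_map iota) (cA : closed (base A)) (cY : closed (base Y)).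
Local Notation J := (join_space R t iota).
Local Notation jm := (@join_map R T A W Y t iota).
Local Notation jl := (join_left R t iota).
Local Notation jc := (@join_cyl R T A W Y t iota).
Local Notation jr := (join_right R t iota).

(** Points over the bases of [A] and [Y] are left out, because the reduced cylinder identifies some
    of them with points of the left end, which have no coordinate in [T]. What is left is open as
    the bases are closed. *)
Let N_cyl (a : A) (s : R) : Prop :=
  [/\ 0 < s, ~ base A a & s < 1 \/ ~ base Y (iota a)].

Definition near_right : set J :=
  join_rec (fun _ _ => False) (fun _ => N_cyl) (fun _ y => ~ base Y y).

Definition near_right_proj : J -> T :=
  join_rec (fun _ _ => x0) (fun x a s => if `[< N_cyl a s >] then x else x0)
    (fun x y => if `[< ~ base Y y >] then x else x0).

Let N0 (a : A) : N_cyl a 0 = False.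
Proof. by apply/propext; split => // -[]; rewrite ltxx. Qed.

Let N1 (a : A) : N_cyl a 1 = (~ base Y (iota a)).
Proof.
apply/propext; split => [[_ _ [|//]]|Ya]; first by rewrite ltxx.
by split; [exact: ltr01|move=> /miota.2|right].
Qed.

Let Nb (a : A) s : base A a -> N_cyl a s = False.
Proof. by move=> Aa; apply/propext; split => // -[]. Qed.

Let near_right_left w a : near_right (jl w a) = False.
Proof.
by apply: (join_rec_left (p := fun _ _ => False)) => *;
  [exact: N0|exact: N1|exact: Nb].
Qed.

Lemma near_right_cyl x a s : near_right (jc x a s) = N_cyl a (set_val s).
Proof.
by apply: (join_rec_cyl (m := fun _ => N_cyl)) => *;
  [exact: N0|exact: N1|exact: Nb].
Qed.

Lemma near_right_right x y : near_right (jr x y) = (~ base Y y).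
Proof.
by apply: (join_rec_right (q := fun _ y => ~ base Y y)) => *;
  [exact: N0|exact: N1|exact: Nb].
Qed.

Let P0 (x : T) (a : A) : (if `[< N_cyl a 0 >] then x else x0) = x0.
Proof. by rewrite N0 asboolF. Qed.

Let P1 (x : T) (a : A) : (if `[< N_cyl a 1 >] then x else x0) =
  if `[< ~ base Y (iota a) >] then x else x0.
Proof. by rewrite N1. Qed.

Let Pb (x : T) (a : A) s : base A a ->
  (if `[< N_cyl a s >] then x else x0) = x0.
Proof. by move=> Aa; rewrite Nb// asboolF. Qed.

Lemma near_right_proj_cyl x a s : near_right_proj (jc x a s) =
  if `[< N_cyl a (set_val s) >] then x else x0.
Proof.
by apply: (join_rec_cyl (m := fun x a s => if `[< N_cyl a s >] then x else x0))
  => *;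
  [exact: P0|exact: P1|exact: Pb].
Qed.

Lemma near_right_proj_right x y : near_right_proj (jr x y) =
  if `[< ~ base Y y >] then x else x0.
Proof.
by apply: (join_rec_right (q := fun x y => if `[< ~ base Y y >] then x else x0))
  => *;
  [exact: P0|exact: P1|exact: Pb].
Qed.

Let open_preimage (X1 X2 : topologicalType) (h : X1 -> X2) (O : set X2) :
  continuous h -> open O -> open (h @^-1` O).
Proof. by move=> ch oO; apply: open_comp. Qed.

Let open_N_cyl : open [set z : T * A * unitI R | N_cyl z.1.2 (set_val z.2)].
Proof.
pose h (z : T * A * unitI R) := set_val z.2.
pose k (z : T * A * unitI R) := z.1.2.
have ch : continuous h.
  by move=> z; apply: (@for_continuous_comp _ _ _ z snd);
    [exact: cvg_snd|exact: set_val_cts].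
have ck : continuous k.
  by move=> z; apply: (@for_continuous_comp _ _ _ z fst);
    [exact: cvg_fst|exact: cvg_snd].
rewrite (_ : mkset _ = h @^-1` [set r | 0 < r] `&` (k @^-1` (~` base A) `&`
  (h @^-1` [set r | r < 1] `|` k @^-1` (iota @^-1` (~` base Y))))); last first.
  by apply/seteqP; split => z [] => [? ? ?|? []].
apply: openI; first exact/open_preimage/open_gt.
apply: openI; first exact/open_preimage/closed_openC.
apply: openU; first exact/open_preimage/open_lt.
apply: open_preimage => //; apply: open_preimage; first exact: miota.1.
exact: closed_openC.
Qed.

Let open_N_right : open [set z : T * Y | ~ base Y z.2].
Proof.
apply: (@open_preimage _ _ snd (~` base Y)); last exact: closed_openC.
by move=> z; exact: cvg_snd.
Qed.

Lemma open_near_right : open near_right.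
Proof.
apply: join_open.
- rewrite (_ : mkset _ = set0); first exact: open0.
  by apply/seteqP; split => z //=; rewrite near_right_left.
- rewrite (_ : mkset _ = [set z :
    T * A * unitI R | N_cyl z.1.2 (set_val z.2)])//.
  by apply/seteqP; split => z /=; rewrite near_right_cyl.
- rewrite (_ : mkset _ = [set z : T * Y | ~ base Y z.2])//.
  by apply/seteqP; split => z /=; rewrite near_right_right.
Qed.

Lemma near_right_proj_cts z : near_right z -> {for z,
  continuous near_right_proj}.
Proof.
move: z; apply: (join_for_continuous open_near_right) => [w a|x a s|x y].
- by rewrite near_right_left.
- rewrite near_right_cyl => Nas.
  apply: (@for_continuous_near _ _ (x, a, s) (fun z => z.1.1)).
    have /open_nbhs_nbhs : open_nbhs (x, a, s)
      [set z : T * A * unitI R | N_cyl z.1.2 (set_val z.2)] by split.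
    by apply: filterS => z /= Nz; rewrite near_right_proj_cyl asboolT.
  by apply: (@for_continuous_comp _ _ _ (x, a, s) fst); exact: cvg_fst.
- rewrite near_right_right => Ny.
  apply: (@for_continuous_near _ _ (x, y) fst); last exact: cvg_fst.
  have /open_nbhs_nbhs : open_nbhs (x,
    y) [set z : T * Y | ~ base Y z.2] by split.
  by apply: filterS => z /= Nz; rewrite near_right_proj_right asboolT.
Qed.

Lemma near_right_projE z : near_right z -> t (near_right_proj z) = (jm z).1.
Proof.
move: z; apply: join_space_ind => [w a|x a s|x y].
- by rewrite near_right_left.
- by rewrite near_right_cyl => Nas;
    rewrite near_right_proj_cyl asboolT// join_map_cyl.
- by rewrite near_right_right => Ny;
    rewrite near_right_proj_right asboolT// join_map_right.
Qed.

(** A point fails to be in [near_right] if it has height zero, or a based coordinate in [A], or lies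
    in the right end over the base of [Y]. In each case [near_left] holds, in the last one because
    [sg'] equals 1 there. *)
Lemma near_leftU_near_right al sg al' sg' :
  @ndr_data R A al sg -> @ndr_data R Y al' sg' ->
  forall z, near_left al sg sg' z \/ near_right z.
Proof.
move=> ndrA ndrY; apply: join_space_ind => [w a|x a s|x y].
- by left; rewrite (near_left_left t ndrA ndrY miota).
- have [Aa|nAa] := pselect (base A a).
    by left; exact: (near_left_cyl_base t ndrA ndrY).
  have [Ya|nYa] := pselect (base Y (iota a)); last first.
    have [s0|s0] := leP (set_val s) 0.
      by left; rewrite (near_left_cyl t ndrA ndrY miota); apply: Or31; lra.
    by right; rewrite near_right_cyl; split => //; right.
  have [s1|s1] := ltP (set_val s) 1; last first.
    left; rewrite (_ : jc x a s = jr x (iota a)).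
      rewrite (near_left_right t ndrA ndrY miota) (ndr_height_base ndrY)//.
      exact/clamp_gt0/ltr01.
    by rewrite -[s]set_val_unitIK join_right_cyl.
  have [s0|s0] := leP (set_val s) 0.
    by left; rewrite (near_left_cyl t ndrA ndrY miota); apply: Or31; lra.
  by right; rewrite near_right_cyl; split => //; left.
- rewrite (near_left_right t ndrA ndrY miota) near_right_right.
  have [Yy|] := pselect (base Y y); last by right.
  by left; rewrite (ndr_height_base ndrY)//; exact/clamp_gt0/ltr01.
Qed.

End JoinRight.

(** * Coordinates of the powers of [Y], and the open cover of the Whitehead spaces *)

Fixpoint power_proj (Y : bspace) (n i : nat) : power Y n -> Y :=
  if n is m.+1 return power Y n -> Y then
    fun z => if i == m.+1 then z.2 else power_proj i z.1
  else idfun.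

Lemma power_proj_diagonal (Y : bspace) n i (y : Y) :
  power_proj i (diagonal_map n y) = y.
Proof. by elim: n => //= n IH; case: ifP. Qed.

Lemma continuous_power_proj (Y : bspace) n i : continuous (@power_proj Y n i).
Proof.
elim: n => [|n IH] z /=; first exact: cvg_id.
case: (i == n.+1); first exact: cvg_snd.
by apply: (@for_continuous_comp _ _ _ z fst); [exact: cvg_fst|exact: IH].
Qed.

Lemma base_power_proj (Y : bspace) n i z :
  base (power Y n) z -> base Y (power_proj i z).
Proof.
elim: n z => //= n IH [w y] /= [bw by_].
by case: ifP => // _; exact: IH.
Qed.

(** An empty base in the source turns [lift_on] into its free version, without a second
    definition. *)
Definition unbased (X : bspace) : bspace := @BSpace X set0.

Section Unbased.
Variables (R : realType) (X A Y : bspace) (iota : A -> Y) (g : X ->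
  Y) (U : set X).

Lemma lift_on_unbased :
  lift_on R iota g U -> @lift_on R (unbased X) A Y iota g U.
Proof. by move=> [l [H [? ? ? ? _ _]]]; exists l, H. Qed.

Lemma lift_on_based : U `&` base X = set0 ->
  @lift_on R (unbased X) A Y iota g U -> lift_on R iota g U.
Proof.
move=> UX [l [H [? ? ? ? _ _]]]; exists l, H; split => // [x|x r] Ux bx.
- by have : (U `&` base X) x by []; rewrite UX.
- by have : (U `&` base X) x by []; rewrite UX.
Qed.

End Unbased.

Lemma open_setI_preimage (X Y : topologicalType) (k : X ->
  Y) (W : set X) (U : set Y) :
  open W -> (forall x, W x -> {for x, continuous k}) -> open U ->
  open (W `&` k @^-1` U).
Proof.
move=> oW ck oU; rewrite openE => x [Wx Ukx]; apply: filterI.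
  exact: open_nbhs_nbhs.
by apply: (ck x Wx); exact: open_nbhs_nbhs.
Qed.

Section WhiteheadCover.
Variables (R : realType) (A Y : bspace) (iota : A -> Y).
Variables (al : A * R -> A) (sg : A * R -> R) (al' : Y * R -> Y) (sg' : Y * R ->
  R).
Hypotheses (ndrA : ndr_data al sg) (ndrY : ndr_data al' sg').
Hypotheses (miota : is_map iota) (cA : closed (base A)) (cY : closed (base Y)).
Variable a0 : A.
Hypotheses (bA : base A `<=` [set a0]) (bY : base Y `<=` [set iota a0]).

(** The [i]-th set carries a lift of the [i]-th coordinate. Only the last set is pointed: the
    earlier ones are pulled back along [near_right_proj], and [near_right] does not meet the
    base. *)
Lemma wg_cover n : exists U : nat -> set (wg_space R iota n),
  [/\ forall i, (i <= n)%N -> open (U i),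
      forall z, exists2 i, (i <= n)%N & U i z,
      base (wg_space R iota n) `<=` U n,
      lift_on R iota (@power_proj Y n n \o wg_map R iota n) (U n) &
      forall i, (i < n)%N -> @lift_on R (unbased (wg_space R iota n)) A Y iota
        (@power_proj Y n i \o wg_map R iota n) (U i)].
Proof.
elim: n => [|n [U [oU cU _ lUn lU]]].
  exists (fun=> setT); split => //.
  - by move=> i _; exact: openT.
  - by move=> z; exists 0%N.
  - exists idfun, (fun z => iota z.1); split => //.
    + by move=> x _; exact: cvg_id.
    + by move=> x r _; apply: (@for_continuous_comp _ _ _ (x, r) fst);
        [exact: cvg_fst|exact: miota.1].
    + by move=> x r _ bx; exact: miota.2.
pose t := wg_map R iota n.
have x0 : wg_space R iota n by exact: wg_inhabited.
(* The pointed lift over [U n] is weakened to a free one, so that all the old sets are treated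
   alike. *)
have {}lU i : (i <= n)%N -> @lift_on R (unbased (wg_space R iota n)) A Y iota
    (@power_proj Y n i \o wg_map R iota n) (U i).
  by rewrite leq_eqVlt => /orP[/eqP->|/lU//]; exact: lift_on_unbased.
pose N := @near_right R _ A _ Y t iota.
pose p := @near_right_proj R _ A _ Y t iota x0.
have oN : open N by exact: open_near_right.
have cp z : N z -> {for z, continuous p} by exact: near_right_proj_cts.
exists (fun i => if i == n.+1 then @near_left R _ A _ Y t iota al sg sg' else N
  `&` p @^-1` U i).
split.
- move=> i; case: eqP => [_ _|/eqP ni];
    first exact: (open_near_left ndrA ndrY miota).
  rewrite leq_eqVlt (negbTE ni) /= => ni'.
  by apply: open_setI_preimage => //; exact: oU.
- move=> z; have [Vz|Nz] := near_leftU_near_right miota ndrA ndrY z.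
    by exists n.+1 => //; rewrite eqxx.
  have [i ni Ui] := cU (p z); exists i; first exact: leqW.
  by rewrite ltn_eqF// ltnS.
- by rewrite eqxx => z; exact: (base_near_left ndrA ndrY miota).
- rewrite eqxx.
  have := lift_on_near_left t ndrA ndrY miota bA bY; congr lift_on.
  by apply/funext => z /=; rewrite eqxx.
- move=> i ni; rewrite ltn_eqF//.
  have {}lU := lU i ni.
  have : @lift_on R (unbased (wg_space R iota n.+1)) A Y iota
      ((@power_proj Y n i \o wg_map R iota n) \o p) (N `&` p @^-1` U i).
    apply: (@lift_on_comp R (unbased (wg_space R iota n)) A Y iota
      (unbased (wg_space R iota n.+1)) p _ _ (U i)) lU => //.
      by move=> x [/cp].
    by move=> x [].
  (* A constant homotopy: [near_right_projE] identifies the two maps, but only over [near_right]. *)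
  apply: (@lift_on_homotopy R (unbased (wg_space R iota n.+1)) _ _ _ _ _
    (fun z => power_proj i (wg_map R iota n.+1 z.1).1)).
  + move=> z r _.
    apply: (@for_continuous_comp _ _ _ (z,
      r) (fun z => (wg_map R iota n.+1 z.1).1));
      last exact: continuous_power_proj.
    apply: (@for_continuous_comp _ _ _ (z,
      r) (fun z => wg_map R iota n.+1 z.1));
      last exact: cvg_fst.
    apply: (@for_continuous_comp _ _ _ (z, r) fst); first exact: cvg_fst.
    exact: (is_map_wg R miota n.+1).1.
  + by move=> z [Nz _]; exact/esym/(congr1 (power_proj i))/(near_right_projE x0
      miota Nz).
  + by move=> z _ /=; rewrite ltn_eqF.
  + by [].
Qed.

End WhiteheadCover.

(** * From free to pointed lifts *)

(* The lifts need not be pointed on the sets [U i] with [i < n]: collapse a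
   neighbourhood of the basepoint, take the constant lift near the basepoint and
   use [U n] to cover the rest of that neighbourhood. *)
Lemma pointed_cover (R : realType) (X A Y : bspace) (iota : A -> Y) (f : X -> Y)
    (al : X * R -> X) (sg : X * R -> R) (a0 : A) (n : nat) (U : nat -> set X) :
  ndr_data al sg -> is_map f ->
  base Y `<=` [set iota a0] -> base Y `<=` iota @` base A ->
  base A `<=` [set a0] ->
  (forall i, (i <= n)%N -> open (U i)) ->
  (forall z, exists2 i, (i <= n)%N & U i z) ->
  base X `<=` U n -> lift_on R iota f (U n) ->
  (forall i, (i < n)%N -> @lift_on R (unbased X) A Y iota f (U i)) ->
  exists V : nat -> set X,
    [/\ forall i, (i <= n)%N -> open (V i),
        forall x, exists2 i, (i <= n)%N & V i x,
        forall i, (i <= n)%N -> base X `<=` V i &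
        forall i, (i <= n)%N -> lift_on R iota f (V i)].
Proof.
move=> ndrX [cf bf] bY bYA bA oU cU bU lUn lU.
pose phi x := al (x, 1).
have cphi : continuous phi.
  move=> x; apply: (@for_continuous_comp2 _ _ _ _ x id (fun=> 1 : R)).
  - exact: cvg_id.
  - exact: cvg_cst.
  - exact: (ndr_cts ndrX).
have csg : continuous (fun x => sg (x, 1)).
  move=> x; apply: (@for_continuous_comp2 _ _ _ _ x id (fun=> 1 : R)).
  - exact: cvg_id.
  - exact: cvg_cst.
  - exact: (ndr_height_cts ndrX).
have phib x : base X x -> phi x = x by move=> bx; rewrite /phi (ndr_base ndrX).
have sgb x : base X x -> sg (x, 1) = 1.
  by move=> bx; rewrite (ndr_height_base ndrX)// clamp_ge1.
(* [phi] is deformed to the identity with the base fixed, so it suffices to lift [f \o phi]. *)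
have phif (V : set X) : lift_on R iota (f \o phi) V -> lift_on R iota f V.
  apply: (@lift_on_homotopy _ _ _ _ _ _ _ (fun z => f (al (z.1, 1 - z.2)))).
  - move=> x r _; apply: (@for_continuous_comp _ _ _ (x, r) (fun z => al (z.1,
      1 - z.2)));
      last exact: cf.
    apply: (@for_continuous_comp2 _ _ _ _ (x, r) fst (fun z => 1 - z.2)).
    + exact: cvg_fst.
    + by apply: cvgB; [exact: cvg_cst|exact: cvg_snd].
    + exact: (ndr_cts ndrX).
  - by move=> x _ /=; rewrite subr0.
  - by move=> x _ /=; rewrite subrr (ndr0 ndrX).
  - by move=> x r _ bx /=; rewrite (ndr_base ndrX)//; exact: bf.
(* The strict inequalities make [N] and [K'] open and disjoint, as [lift_on_setU] requires. The
   level 1/2 between them is covered by the preimage of [U n], since [phi] sends it to the base. *)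
pose N := [set x | 1 / 2 < sg (x, 1)].
pose K' := [set x | sg (x, 1) < 1 / 2].
have oN : open N.
  by apply: (@open_comp _ _ (fun x => sg (x, 1)) [set r | 1 / 2 < r]) => //;
    exact: open_gt.
have oK' : open K'.
  by apply: (@open_comp _ _ (fun x => sg (x, 1)) [set r | r < 1 / 2]) => //;
    exact: open_lt.
have bN : base X `<=` N by move=> x /sgb xE; rewrite /N /= xE; lra.
have NX x : 0 < sg (x, 1) -> base X (phi x) by exact: (ndr_height_gt0 ndrX).
have ophi i : (i <= n)%N -> open (phi @^-1` U i).
  by move=> ni; apply: open_comp => //; exact: oU.
exists (fun i => if i == n then phi @^-1` U n else (K' `&` phi @^-1` U i)
  `|` N).
split.
- move=> i ni; case: eqP => _; first exact: ophi.
  by apply: openU => //; apply: openI => //; exact: ophi.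
- move=> x; have [i ni Ui] := cU (phi x).
  have [s2|s2] := ltP (sg (x, 1)) (1 / 2); last first.
    exists n => //; rewrite eqxx; apply/bU/NX; lra.
  by exists i => //; case: eqP => [<-//|_]; left.
- move=> i ni; case: eqP => _ x bx; last by right; exact: bN.
  by rewrite /= phib//; exact: bU.
- move=> i ni; case: eqP => [_|/eqP in_].
    apply: phif; apply: lift_on_comp lUn => // [x _|x _ bx]; first exact: cphi.
    by rewrite phib.
  have {}lU : @lift_on R (unbased X) A Y iota f (U i).
    by apply: lU; rewrite ltn_neqAle in_.
  apply: phif; apply: lift_on_setU => //.
  + by apply: openI => //; exact: ophi.
  + by rewrite -subset0 => x [[/= K'x _]]; rewrite /N /= ltNge (ltW K'x).
  + apply: lift_on_based.
      rewrite -subset0 => x [[/= K'x _] bx]; move: K'x; rewrite /K' /= sgb//;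
        lra.
    apply: (@lift_on_comp R (unbased X) A Y iota (unbased X) phi _ _ (U i))
      lU => //.
      by move=> x _; exact: cphi.
    by move=> x [].
  (* On [N] the map [f \o phi] takes only the value [iota a0]. *)
  + exists (fun=> a0), (fun=> iota a0); split => //.
    * by move=> x _; exact: cvg_cst.
    * by move=> x r _; exact: cvg_cst.
    * move=> x /= Nx; apply/esym/bY/bf/NX.
      by move: Nx; rewrite /N /=; lra.
    * by move=> x _ /bf/bYA[a Aa _]; rewrite -(bA a Aa).
    * by move=> x r _ bx; rewrite -(bY _ (bf _ bx)); exact: bf.
Qed.

(** * Comparison of the two invariants *)

(** What the two settings have in common. In the free one the bases are empty and [a0] is any point
    of the non-empty space [A]; in the pointed one [a0] is the basepoint. *)
Lemma is_object_base (R : realType) (c : category) (A Y : bspace) (iota : A ->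
  Y) :
  is_object R c A -> is_object R c Y -> is_map iota ->
  exists a0 : A, [/\ base A `<=` [set a0], base Y `<=` [set iota a0],
    base Y `<=` iota @` base A, closed (base A) & closed (base Y)].
Proof.
move=> + + [_ biota]; case: c => /= [[[a0 _] ->] [_ ->]|].
  by exists a0; split => //; exact: closed0.
move=> [a0 A0 [cA _]] [y0 Y0 [cY _]]; exists a0.
have ia : base Y (iota a0) by apply: biota; rewrite A0.
rewrite Y0 in ia; rewrite A0 Y0 -ia; split => //.
- by move=> _ ->; exists a0.
- by rewrite ia.
Qed.

Lemma has_open_lifts_of_wg (R : realType) (c : category) (A X Y : bspace)
    (iota : A -> Y) (f : X -> Y) n :
  is_object R c A -> is_object R c X -> is_object R c Y ->
  is_map iota -> is_map f ->
  has_wg_lift R f iota n -> has_open_lifts R f iota n.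
Proof.
move=> oA oX oY miota mf [l [[cl bl] /homotopic_real[G [cG G0 G1 Gb]]]].
have [a0 [bA bY bYA cA cY]] := is_object_base oA oY miota.
have [al [sg ndrA]] := is_object_ndr oA.
have [al' [sg' ndrY]] := is_object_ndr oY.
have [alX [sgX ndrX]] := is_object_ndr oX.
have [U [oU cU bU lUn lU]] := wg_cover ndrA ndrY miota cA cY bA bY n.
apply/(has_open_liftsP R iota f a0).
(* The [i]-th coordinate of [G] joins the [i]-th coordinate of the Whitehead lift to [f], as all
   coordinates of the diagonal agree. Thus the cover of the Whitehead space pulls back along [l]. *)
have cGi i (x : X) (r : R) : {for (x, r),
  continuous (fun z => power_proj i (G z))}.
  by apply: for_continuous_comp; [exact: cG|exact: continuous_power_proj].
apply: (pointed_cover (U := fun i => l @^-1` U i) ndrX mf bY bYA bA).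
- by move=> i ni; apply: open_comp => //; exact: oU.
- by move=> x; exact: cU.
- by move=> x /bl /bU.
- apply: (@lift_on_homotopy _ _ _ _ _ ((@power_proj Y n n \o wg_map R iota n)
    \o l) _
    (fun z => power_proj n (G z))).
  + by move=> x r _; exact: cGi.
  + by move=> x _; rewrite G0.
  + by move=> x _; rewrite G1 power_proj_diagonal.
  + by move=> x r _ bx; apply: base_power_proj; exact: Gb.
  + apply: lift_on_comp lUn => // [x _|x _ /bl//].
    exact: cl.
- move=> i ni; apply: (@lift_on_homotopy _ (unbased X) _ _ _
    ((@power_proj Y n i \o wg_map R iota n) \o l)
      _ (fun z => power_proj i (G z))).
  + by move=> x r _; exact: cGi.
  + by move=> x _; rewrite G0.
  + by move=> x _; rewrite G1 power_proj_diagonal.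
  + by [].
  + apply: (@lift_on_comp R (unbased (wg_space R iota n)) A Y iota (unbased X)
      l _ _ (U i))
      (lU i ni) => //.
    by move=> x _; exact: cl.
Qed.

Lemma has_wg_lift_of_open (R : realType) (c : category) (A X Y : bspace)
    (iota : A -> Y) (f : X -> Y) n :
  is_object R c A -> is_object R c Y -> is_map iota -> is_map f ->
  normal_space X -> has_open_lifts R f iota n -> has_wg_lift R f iota n.
Proof.
move=> oA oY miota mf nX.
have [a0 [_ _ bYA _ _]] := is_object_base oA oY miota.
move=> /(has_open_liftsP R iota f a0)[U [oU cU _ lU]].
by apply/lift_on_setTP; exact: (lift_on_wg miota bYA a0 mf nX oU cU lU).
Qed.

Lemma least_le (S S' : set nat) : S `<=` S' -> (least S' <= least S)%O.
Proof.
move=> SS'; rewrite /least; case: pselect => [ex'|nex'].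
  case: pselect => [ex|nex]; last exact: leey.
  case: ex_minnP => m _ mmin; case: ex_minnP => n /asboolP Sn _.
  by rewrite lee_fin lez_nat; apply/mmin/asboolP/SS'.
case: pselect => // ex; exfalso; apply: nex'; have [n /asboolP Sn] := ex;
  exists n.
exact/asboolP/SS'.
Qed.

Lemma liftcat_op_WG (R : realType) (c : category) (A X Y : bspace)
    (iota : A -> Y) (f : X -> Y) :
  is_object R c A -> is_object R c X -> is_object R c Y ->
  is_map iota -> is_map f ->
  (liftcat_op R f iota <= liftcat_WG R f iota)%O /\
  (normal_space X -> liftcat_op R f iota = liftcat_WG R f iota).
Proof.
move=> oA oX oY miota mf; split.
  apply: least_le => n; exact: (has_open_lifts_of_wg oA oX oY miota mf).
move=> nX; congr least; apply/seteqP; split => n.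
- exact: (has_wg_lift_of_open oA oY miota mf nX).
- exact: (has_open_lifts_of_wg oA oX oY miota mf).
Qed.

Theorem theorem60 (R : realType) (c : category) :
  (forall (A X Y : bspace) (iota : A -> Y) (f : X -> Y),
      is_object R c A -> is_object R c X -> is_object R c Y ->
      is_map iota -> is_map f ->
      (liftcat_op R f iota <= liftcat_WG R f iota)%O /\
      (normal_space X -> liftcat_op R f iota = liftcat_WG R f iota)) /\
  (forall (A X : bspace) (iota : A -> X),
      is_object R c A -> is_object R c X -> is_map iota ->
      (secat_op R iota <= secat_WG R iota)%O /\
      (normal_space X -> secat_op R iota = secat_WG R iota)).
Proof.
split=> [A X Y iota f oA oX oY miota mf|A X iota oA oX miota].
  exact: liftcat_op_WG oA oX oY miota mf.
(* Both versions of [secat] unfold to [liftcat] for [idfun], which only has to be seen to be a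
   map. *)
apply: (liftcat_op_WG oA oX oX miota); split => // x.
exact: cvg_id.
Qed.
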